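(* Let $n\ge 3$ and $S\subseteq\{1,\dots,n-2\}$. If $S=\{1,2,\dots,i\}$ for some $0\le i\le n-2$ (with $i=0$ meaning $S=\emptyset$), then $b'_S(n)=1$; otherwise $b'_S(n)>1$.
   Context: $\Pi_n$ is the lattice of set partitions of $\{1,\dots,n\}$ ordered by refinement, with minimum $\hat 0$ (all singletons) and maximum $\hat 1$ (one block); the rank of a partition with $k$ blocks is $n-k$. The symmetric group $S_n$ acts on $\Pi_n$ by permuting $\{1,\dots,n\}$, and hence permutes chains. For $T\subseteq\{1,\dots,n-2\}$ let $\alpha_T$ be the permutation representation of $S_n$ (over $\mathbb{C}$) on the set of chains $\hat 0<x_1<\dots<x_m<\hat 1$ whose set of ranks is exactly $T$. For $S\subseteq\{1,\dots,n-2\}$ put $\beta_S=\sum_{T\subseteq S}(-1)^{|S-T|}\alpha_T$ (equivalently, the $S_n$-representation on the top reduced homology of the order complex of the rank-selected subposet $\Pi_n^S$ of elements with rank in $S$). Let $b'_S(n)$ be the multiplicity of the trivial representation of the Young subgroup $S_{n-1}\times S_1\subseteq S_n$ in the restriction of $\beta_S$ to $S_{n-1}\times S_1$. *)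

(* Defs.v *)
From mathcomp Require Import all_boot all_order all_algebra all_fingroup.
From mathcomp Require Import all_solvable all_field all_character.

Set Implicit Arguments.
Unset Strict Implicit.
Unset Printing Implicit Defensive.

Import GroupScope GRing.Theory.
Local Open Scope ring_scope.

(* The ground set {1, ..., n} is 'I_n, with k represented by the ordinal of
   value k - 1. Representations are over algC instead of the complex numbers. *)

Section PermutationRepresentation.

Variables (aT : finGroupType) (rT : finType) (G : {group aT}).
Variables (to : {action aT &-> rT}) (X : {set rT}).
Hypothesis actsX : [acts G, on X | to].

(* MathComp representations act on row vectors, on the right: the basis vector
   indexed by x is sent by g to the one indexed by to x g. *)
Definition actor_mx (g : aT) : 'M[algC]_#|X| :=
  \matrix_(i, j) (to (enum_val i) g == enum_val j)%:R.

Lemma actor_mx_repr : mx_repr G actor_mx.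
Proof.
split=> [|g h gG hG]; apply/matrixP=> i j; rewrite !mxE.
  by rewrite act1 (inj_eq enum_val_inj).
have Xg : to (enum_val i) g \in X by rewrite (acts_act actsX gG) enum_valP.
rewrite (bigD1 (enum_rank_in Xg (to (enum_val i) g))) //= !mxE.
rewrite enum_rankK_in // eqxx mul1r actM big1 ?addr0 // => k neq_k.
rewrite !mxE; case: eqP => [Ek | _]; last by rewrite mul0r.
by case/eqP: neq_k; apply: enum_val_inj; rewrite enum_rankK_in.
Qed.

Definition action_repr := MxRepresentation actor_mx_repr.

End PermutationRepresentation.

Section PartitionLattice.

Variable n : nat.

Definition setpart : {set {set {set 'I_n}}} :=
  [set x | partition x [set: 'I_n]].

Definition refines (x y : {set {set 'I_n}}) : bool :=
  [forall B in x, exists C in y, B \subset C].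

Definition part0 : {set {set 'I_n}} := [set [set i] | i : 'I_n].
Definition part1 : {set {set 'I_n}} := [set [set: 'I_n]].

Definition rank_part (x : {set {set 'I_n}}) : nat := (n - #|x|)%N.

(* A chain 0 < x_1 < ... < x_m < 1 is encoded by the set {x_1, ..., x_m}. *)
Definition proper_chain (c : {set {set {set 'I_n}}}) : bool :=
  (c \subset setpart :\: [set part0; part1])
  && [forall x in c, forall y in c, refines x y || refines y x].

(* No rank is lost by ranging over 'I_n: for 0 < n a partition has at least one
   block, hence rank < n. *)
Definition rank_set (c : {set {set {set 'I_n}}}) : {set 'I_n} :=
  [set r : 'I_n | [exists x in c, rank_part x == r]].

Definition chains (T : {set 'I_n}) : {set {set {set {set 'I_n}}}} :=
  [set c | proper_chain c && (rank_set c == T)].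

(* The action on chains: the natural action of 'S_n on points, lifted to blocks,
   then to partitions, then to sets of partitions. *)
Definition block_action : {action 'S_n &-> {set 'I_n}} :=
  (('P : {action 'S_n &-> 'I_n})^*)%act.
Definition part_action : {action 'S_n &-> {set {set 'I_n}}} :=
  (block_action^*)%act.
Definition chain_action : {action 'S_n &-> {set {set {set 'I_n}}}} :=
  (part_action^*)%act.

Lemma setpart_act (s : 'S_n) x :
  x \in setpart -> part_action x s \in setpart.
Proof.
have blockE (B : {set 'I_n}) i : (s i \in block_action B s) = (i \in B).
  by rewrite /= setactE mem_imset //; apply: act_inj.
rewrite !inE => /and3P[/eqP covx trivx x0]; apply/and3P; split.
- apply/eqP/setP=> i; rewrite inE; apply/bigcupP.
  have : s^-1%g i \in cover x by rewrite covx inE.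
  case/bigcupP=> B xB iB; exists (block_action B s); last first.
    by rewrite -[i](permKV s) blockE.
  by rewrite /= setactE imset_f.
- apply/trivIsetP=> _ _ /imsetP[B xB ->] /imsetP[C xC ->] neBC.
  have /(trivIsetP trivx _ _ xB xC) : B != C.
    by apply: contraNneq neBC => ->.
  rewrite -!setI_eq0 => /eqP BC0; apply/eqP/setP=> i.
  by rewrite -[i](permKV s) !inE !blockE -in_setI BC0 inE.
- apply: contra x0 => /imsetP[B xB /esym/eqP].
  by rewrite /= setactE imset_eq0 => /eqP <-.
Qed.

Lemma refines_act (s : 'S_n) x y :
  refines x y -> refines (part_action x s) (part_action y s).
Proof.
move/forall_inP=> xy; apply/forall_inP=> _ /imsetP[B xB ->].
have /exists_inP[C yC sBC] := xy _ xB.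
apply/exists_inP; exists (block_action C s); first by apply: imset_f.
by rewrite /= !setactE imsetS.
Qed.

Lemma part0_act (s : 'S_n) : part_action part0 s = part0.
Proof.
apply/setP=> B; apply/imsetP/imsetP=> [[_ /imsetP[i _ ->] ->] | [i _ ->]].
  by exists (s i); rewrite //= setactE imset_set1.
exists [set s^-1%g i]; first by apply: imset_f.
by rewrite /= setactE imset_set1 /= apermE permKV.
Qed.

Lemma part1_act (s : 'S_n) : part_action part1 s = part1.
Proof.
rewrite /= setactE imset_set1 /=; congr [set _]; apply/setP=> i.
by rewrite setactE -[i](permKV s) mem_imset ?inE //; apply: act_inj.
Qed.

Lemma proper_chain_act (s : 'S_n) c :
  proper_chain c -> proper_chain (chain_action c s).
Proof.
case/andP=> /subsetP sc /forall_inP cc; apply/andP; split.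
  apply/subsetP=> _ /imsetP[x xc ->]; move: (sc x xc).
  rewrite in_setD => /andP[xN01 xP].
  rewrite in_setD setpart_act // andbT; apply: contra xN01.
  rewrite !inE -{1}(part0_act s) -{1}(part1_act s).
  by rewrite !(inj_eq (act_inj part_action s)).
apply/forall_inP=> _ /imsetP[x xc ->]; apply/forall_inP=> _ /imsetP[y yc ->].
have /forall_inP/(_ y yc)/orP[xy | yx] := cc x xc.
  by rewrite refines_act.
by rewrite orbC refines_act.
Qed.

Lemma rank_set_act (s : 'S_n) c : rank_set (chain_action c s) = rank_set c.
Proof.
have rankE x : rank_part (part_action x s) = rank_part x.
  by rewrite /rank_part card_setact.
apply/setP=> r; rewrite !inE; apply/exists_inP/exists_inP.
  by case=> _ /imsetP[x xc ->]; rewrite rankE; exists x.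
by case=> x xc xr; exists (part_action x s); rewrite ?rankE //; apply: imset_f.
Qed.

Lemma acts_chains (T : {set 'I_n}) :
  [acts [set: 'S_n]%G, on chains T | chain_action].
Proof.
apply/subsetP=> s _; rewrite inE in_setT inE; apply/subsetP=> c.
by rewrite !inE rank_set_act => /andP[/(proper_chain_act s) -> ->].
Qed.

Definition alpha_repr (T : {set 'I_n}) := action_repr (acts_chains T).

Definition alpha (T : {set 'I_n}) : 'CF([set: 'S_n]) := cfRepr (alpha_repr T).

Definition beta (S : {set 'I_n}) : 'CF([set: 'S_n]) :=
  \sum_(T : {set 'I_n} | T \subset S) (-1) ^+ #|S :\: T| *: alpha T.

(* S_(n-1) x S_1, as the setwise stabiliser of {1, ..., n-1}. *)
Definition young : {group 'S_n} :=
  'N([set i : 'I_n | (i < n.-1)%N] | 'P)%G.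

(* For the virtual character beta S, the multiplicity of the trivial character
   is its coefficient in the basis of irreducible characters. *)
Definition bprime (S : {set 'I_n}) : algC :=
  '['Res[young] (beta S), 1].

End PartitionLattice.

(* Main.v *)
(* Averaging over the Young subgroup G turns b'_S into an alternating sum, over
   T in S, of the dimensions of the spaces W_T of G-invariant functions on maximal
   chains that depend only on the elements with rank in T.  If a maximal chain m
   can be improved, for a suitable key, by changing its element of rank r, call r
   a descent of m.  The only chain without descents outside T, among those that
   agree with it on T, is the one of least key, so that the indicator functions
   of "agreeing with m on the descents of m" form a basis adapted to all spaces of
   functions depending only on the ranks in T.  Averaging, inclusion-exclusion
   gives b'_S = dim W_S - dim N_S, where N_S is the sum of the W_(S - s), s in S.

   Lower bound.  Order the bars of the path on {1, ..., n} by a permutation, and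
   remove them one at a time: this is a maximal chain.  The signed sum over the
   permutations having prescribed sets of removed bars at the ranks outside S
   kills N_S, because exchanging steps s and s + 1 only affects rank s.  One such
   functional gives b'_S >= 1; if h is not in S but h + 1 is, then the identity
   and the transposition across h give two independent ones.

   Upper bound for S = {1, ..., t}.  Modulo N_S, the indicator of an orbit is a
   combination of those obtained by moving one element of the chain.  Consider a
   chain that first adds singletons one by one to the marked block, and then merges
   pairs of unmarked singletons: exchanging steps shows that it lies in the span
   of the chain in which only the marked block grows. *)
Require Import Defs.
From mathcomp Require Import all_boot all_order all_algebra all_fingroup.
From mathcomp Require Import all_solvable all_field all_character.
From mathcomp Require Import zify lra.

Set Implicit Arguments.
Unset Strict Implicit.
Unset Printing Implicit Defensive.
Import GroupScope Order.TTheory GRing.Theory Num.Theory.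
Local Open Scope ring_scope.

(** * Rank-selected invariant functions *)

Section RankSelection.

Variables (M I : finType) (P : eqType) (lev : M -> I -> P).
Variables (gT : finGroupType) (G : {group gT}) (to : {action gT &-> M}).
Hypothesis lev_act :
  forall m m' r g, lev m r = lev m' r -> lev (to m g) r = lev (to m' g) r.

Implicit Types (m : M) (S T R : {set I}).

Definition agree T m m' := [forall r in T, lev m r == lev m' r].
Definition oagree T m m' := [exists g in G, agree T (to m g) m'].

Lemma agreeP T m m' : reflect {in T, lev m =1 lev m'} (agree T m m').
Proof. exact: eqfun_inP. Qed.

Lemma agree_refl T m : agree T m m.
Proof. exact/agreeP. Qed.

Lemma agree_sym T m m' : agree T m m' = agree T m' m.
Proof. by apply/agreeP/agreeP=> h r rT; rewrite h. Qed.

Lemma agree_trans T : transitive (agree T).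
Proof.
by move=> m2 m1 m3 /agreeP h1 /agreeP h2; apply/agreeP=> r rT; rewrite h1 ?h2.
Qed.

Lemma agree_sub T S m m' : T \subset S -> agree S m m' -> agree T m m'.
Proof.
by move=> /subsetP sTS /agreeP h; apply/agreeP=> r /sTS; apply: h.
Qed.

Lemma agree_act T m m' g : agree T m m' -> agree T (to m g) (to m' g).
Proof. by move/agreeP=> h; apply/agreeP=> r /h; apply: lev_act. Qed.

Lemma oagree_act T m m' g : g \in G -> agree T (to m g) m' -> oagree T m m'.
Proof. by move=> gG h; apply/exists_inP; exists g. Qed.

Lemma agree_oagree T m m' : agree T m m' -> oagree T m m'.
Proof. by move=> h; apply: (oagree_act (group1 G)); rewrite act1. Qed.

Lemma oagree_refl T m : oagree T m m.
Proof. exact/agree_oagree/agree_refl. Qed.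

Lemma oagree_sym T m m' : oagree T m m' = oagree T m' m.
Proof.
have imp m1 m2 : oagree T m1 m2 -> oagree T m2 m1.
  case/exists_inP=> g gG /(agree_act g^-1%g); rewrite actK agree_sym => h.
  by apply: oagree_act h; rewrite groupV.
by apply/idP/idP; apply: imp.
Qed.

Lemma oagree_trans T : transitive (oagree T).
Proof.
move=> m2 m1 m3 /exists_inP[g gG h1] /exists_inP[k kG h2].
apply: (oagree_act (g := (g * k)%g)); first exact: groupM.
by rewrite actM; apply: agree_trans (agree_act k h1) h2.
Qed.

Lemma oagree_sub T S m m' : T \subset S -> oagree S m m' -> oagree T m m'.
Proof.
by move=> sTS /exists_inP[g gG /(agree_sub sTS) h]; apply: oagree_act h.
Qed.

Lemma oagree_congr T m1 m2 m : oagree T m1 m2 -> oagree T m1 m = oagree T m2 m.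
Proof.
by move=> h; apply/idP/idP; apply: oagree_trans; rewrite // oagree_sym.
Qed.

Definition chainfun := {ffun M -> rat^o}.

Definition orbit_ind T m : chainfun := [ffun m' => (oagree T m m')%:R].
Definition invfun T : {vspace chainfun} := <<[seq orbit_ind T m | m : M]>>%VS.

Lemma orbit_ind_in T m : orbit_ind T m \in invfun T.
Proof. by apply: memv_span; apply: image_f. Qed.

Lemma sum_orbit_ind T (f : chainfun) :
    (forall m m', oagree T m m' -> f m = f m') ->
  f = \sum_m (f m / #|[set m' | oagree T m m']|%:R) *: orbit_ind T m.
Proof.
move=> fE; apply/ffunP=> m; rewrite sum_ffunE.
pose c := #|[set m' | oagree T m m']|.
have c0 : c%:R != 0 :> rat.
  rewrite pnatr_eq0 -lt0n; apply/card_gt0P; exists m.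
  by rewrite inE oagree_refl.
transitivity (\sum_(m' in [set m' | oagree T m m']) f m / c%:R).
  by rewrite sumr_const -/c -[RHS](@mulr_natr rat) divfK.
rewrite big_mkcond /=; apply: eq_bigr => m' _; rewrite inE !ffunE.
rewrite oagree_sym; case: ifP => h /=; last by rewrite [_ *: _]mulr0.
rewrite (fE _ _ h) [_ *: _]mulr1; congr (_ / _%:R).
apply: eq_card => m2; rewrite !inE; exact/esym/oagree_congr.
Qed.

Lemma invfunP T (f : chainfun) :
  reflect (forall m m', oagree T m m' -> f m = f m') (f \in invfun T).
Proof.
apply: (iffP idP) => [|/sum_orbit_ind ->]; last first.
  by apply: memv_suml => m _; apply/memvZ/orbit_ind_in.
have sz : size [seq orbit_ind T m | m : M] = #|M| by rewrite size_map -cardE.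
move=> fW m m' mm'; rewrite (coord_span (X := in_tuple _) fW) !sum_ffunE.
apply: eq_bigr => i _; rewrite !ffunE /=.
have /mapP[m2 _ ->] : [seq orbit_ind T m0 | m0 : M]`_i
    \in [seq orbit_ind T m0 | m0 : M] by apply: mem_nth.
by rewrite !ffunE ![oagree T m2 _]oagree_sym (oagree_congr _ mm').
Qed.

Lemma invfun_sub T S : T \subset S -> (invfun T <= invfun S)%VS.
Proof.
move=> sTS; apply/subvP=> f /invfunP fT; apply/invfunP=> m m' /(oagree_sub sTS).
exact: fT.
Qed.

Lemma dim_invfun T :
  \dim (invfun T) = #|[set [set m' | oagree T m m'] | m : M]|.
Proof.
set Q := [set _ | _ : M].
pose X := [tuple [ffun m => (m \in enum_val i)%:R] : chainfun | i < #|Q|].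
have EX (i : 'I_#|Q|) : X`_i = [ffun m => (m \in enum_val i)%:R].
  by rewrite -tnth_nth tnth_mktuple.
have -> : invfun T = <<X>>%VS.
  apply: subv_anti; apply/andP; split; apply/span_subvP => f.
    case/mapP=> m _ ->; have mQ : [set m' | oagree T m m'] \in Q.
      exact: imset_f.
    have -> : orbit_ind T m = X`_(enum_rank_in mQ [set m' | oagree T m m']).
      by rewrite EX enum_rankK_in //; apply/ffunP=> m'; rewrite !ffunE inE.
    by apply: memv_span; apply: mem_nth; rewrite size_tuple.
  case/mapP=> i _ ->; have /imsetP[m _ Em] := enum_valP i.
  have -> : [ffun m => (m \in enum_val i)%:R] = orbit_ind T m :> chainfun.
    by rewrite Em; apply/ffunP=> m'; rewrite !ffunE inE.
  exact: orbit_ind_in.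
suff /eqP -> : free X by rewrite size_tuple.
apply/freeP=> k k0 i; have /imsetP[m _ Em] := enum_valP i.
move/ffunP/(_ m): k0; rewrite sum_ffunE ffunE (bigD1 i) //= EX !ffunE Em inE.
rewrite oagree_refl [_ *: _]mulr1 big1 ?addr0 // => j ji; rewrite EX !ffunE.
have /imsetP[m2 _ Em2] := enum_valP j; rewrite Em2 inE.
case h: (oagree T m2 m); last by rewrite [_ *: _]mulr0.
case/eqP: ji; apply: enum_val_inj; rewrite Em Em2; apply/setP=> m3.
by rewrite !inE (oagree_congr _ h).
Qed.

Variable key : M -> nat.

Definition locmin T m :=
  forall r m', r \notin T -> agree (~: [set r]) m' m -> (key m <= key m')%N.

Hypothesis locmin_inj :
  forall T m m', locmin T m -> locmin T m' -> agree T m m' -> m = m'.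

Definition descents m : {set I} :=
  [set r | [exists m', agree (~: [set r]) m' m && (key m' < key m)%N]].

Lemma agree_setC1 T r m m' :
  r \notin T -> agree (~: [set r]) m m' -> agree T m m'.
Proof.
move=> rT; apply: agree_sub; apply/subsetP=> s sT; rewrite !inE.
by apply: contraNneq rT => <-.
Qed.

Lemma descents_sub T m :
  (forall m', agree T m' m -> (key m <= key m')%N) -> descents m \subset T.
Proof.
move=> m_min; apply/subsetP=> r; rewrite inE => /existsP[m' /andP[off_r lt_key]].
apply: contraLR lt_key => rT; rewrite -leqNgt; apply: m_min.
exact: agree_setC1 off_r.
Qed.

Lemma key_lt m m' : agree (descents m) m' m -> m' != m -> (key m < key m')%N.
Proof.
set T := descents m => agr; have min_loc m1 : agree T m1 m ->
    (forall m2, agree T m2 m -> (key m1 <= key m2)%N) -> m1 = m.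
  move=> agr1 min1; apply: (@locmin_inj T) => // [r m2 rT off|r m2 rT off].
    exact: min1 (agree_trans (agree_setC1 rT off) agr1).
  rewrite leqNgt; apply: contra rT => lt; rewrite inE; apply/existsP; exists m2.
  by rewrite off.
case: (@arg_minnP _ m (agree T ^~ m) key (agree_refl T m)) => m1 agr1 min1.
have Em : m1 = m by apply: min_loc => // m2 /min1.
rewrite Em in min1; rewrite ltn_neqAle min1 // andbT.
apply: contraNneq => Ek; apply/eqP/min_loc => // m2 /min1.
by rewrite Ek.
Qed.

Definition descent_ind m : chainfun := [ffun m' => (agree (descents m) m' m)%:R].

Lemma descent_ind_expand T (f : chainfun) :
    (forall m m', agree T m m' -> f m = f m') ->
  exists2 a : M -> rat, forall m, a m != 0 -> descents m \subset T
    & f = \sum_m a m *: descent_ind m.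
Proof.
pose N := (\max_m key m).+1.
have ltN m : (key m < N)%N by rewrite ltnS leq_bigmax.
suff gen k : forall g : chainfun, (forall m m', agree T m m' -> g m = g m') ->
    (forall m, (key m + k < N)%N -> g m = 0) ->
  exists2 a : M -> rat, forall m, a m != 0 -> descents m \subset T
    & g = \sum_m a m *: descent_ind m.
- by move=> fE; apply: (gen N) => // m; rewrite ltnNge leq_addl.
elim: k => [|k IHk] g gE g0.
  exists (fun=> 0) => [m|]; first by rewrite eqxx.
  rewrite big1 => [|m _]; last by rewrite scale0r.
  by apply/ffunP=> m; rewrite ffunE g0 // addn0.
pose A m := (key m + k.+1 == N)%N && (descents m \subset T).
pose a m : rat := if A m then g m else 0.
have [||b bT Eg] := IHk (g - \sum_m a m *: descent_ind m).
- move=> m m' agr; rewrite !ffunE (gE _ _ agr) !sum_ffunE; congr (_ - _).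
  apply: eq_bigr => m1 _; rewrite !ffunE /a; case: ifP => [/andP[_ sDT]|_].
    congr (_ *: _%:R); congr nat_of_bool.
    by apply/idP/idP; apply: agree_trans; [rewrite agree_sym|];
       apply: agree_sub agr.
  by rewrite !scale0r.
- move=> m lt_m; rewrite !ffunE sum_ffunE (bigD1 m) //= !ffunE agree_refl.
  rewrite [_ *: _]mulr1 big1 ?addr0 => [|m1 m1m]; last first.
    rewrite !ffunE /a; case: ifP => [/andP[/eqP key1 _]|_]; last by rewrite scale0r.
    case agr: (agree _ _ _); last by rewrite [_ *: _]mulr0.
    have := key_lt agr; rewrite eq_sym m1m => /(_ isT) lt_key.
    by move: lt_m; rewrite -key1 addnS ltnS leq_add2r leqNgt lt_key.
  rewrite /a; case: ifP => [_|/negbT A'm]; first by rewrite subrr.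
  rewrite subr0; move: lt_m; rewrite leq_eqVlt => /orP[/eqP Em|]; last first.
    by rewrite -addnS; apply: g0.
  case: (@arg_minnP _ m (agree T ^~ m) key (agree_refl T m)) => m1 agr1 min1.
  have le1 := min1 m (agree_refl _ _).
  rewrite (gE m m1) 1?agree_sym // g0 // -Em addnS ltnS ltn_add2r.
  rewrite ltn_neqAle le1 andbT; apply: contraNneq A'm => Ek.
  rewrite /A addnS -Em eqxx /=; apply: descents_sub => m2 /min1.
  by rewrite Ek.
exists (fun m => a m + b m) => [m|].
  rewrite /a; case: ifP => [/andP[_ ->] //|_]; rewrite add0r; exact: bT.
rewrite -[LHS](subrK (\sum_m a m *: descent_ind m)) Eg addrC -big_split /=.
by apply: eq_bigr => m _; rewrite scalerDl.
Qed.

Lemma descent_ind_free (a : M -> rat) :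
  \sum_m a m *: descent_ind m = 0 -> forall m, a m = 0.
Proof.
move=> a0 m; apply/eqP/negPn/negP=> am.
case: (@arg_minnP _ m (fun m => a m != 0) key am) => {am}m am min_m.
case/eqP: am; move/ffunP/(_ m): a0; rewrite sum_ffunE ffunE (bigD1 m) //= !ffunE.
rewrite agree_refl [_ *: _]mulr1 big1 ?addr0 // => m1 m1m; rewrite !ffunE.
have [-> | am1] := eqVneq (a m1) 0; first by rewrite scale0r.
case agr: (agree _ _ _); last by rewrite [_ *: _]mulr0.
have := key_lt agr; rewrite eq_sym m1m => /(_ isT).
by rewrite ltnNge min_m.
Qed.

Definition lower S R : {vspace chainfun} := (\sum_(s in R) invfun (S :\ s))%VS.

Lemma invfun_finv T (f : chainfun) :
  f \in invfun T -> forall m m', agree T m m' -> f m = f m'.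
Proof. by move/invfunP=> fT m m' /agree_oagree; apply: fT. Qed.

Lemma orbit_mean T (h : chainfun) :
    (forall m m', agree T m m' -> h m = h m') ->
  ([ffun m => \sum_(g in G) h (to m g)] : chainfun) \in invfun T.
Proof.
move=> hT; apply/invfunP=> m m' /exists_inP[k kG agr]; rewrite !ffunE.
rewrite (reindex_inj (mulgI k)) /=; apply: eq_big => g; first by rewrite groupMl.
by move=> _; apply: hT; rewrite actM; apply: agree_act.
Qed.

Lemma lower_cap S R r :
  (invfun (S :\ r) :&: lower S R)%VS = lower (S :\ r) R.
Proof.
apply: subv_anti; apply/andP; split; last first.
  rewrite subv_cap; apply/andP; split; apply/subv_sumP=> s sR.
    exact/invfun_sub/subD1set.
  by apply: (sumv_sup s) => //; apply/invfun_sub/setSD/subD1set.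
apply/subvP=> f; rewrite memv_cap => /andP[fr /memv_sumP[fs fsW Ef]].
have [a aD Ea] := descent_ind_expand (invfun_finv fr).
have /fin_all_exists[b bP] s : exists b : M -> rat, s \in R ->
    (forall m, b m != 0 -> descents m \subset S :\ s)
    /\ fs s = \sum_m b m *: descent_ind m.
  case sR: (s \in R); last by exists (fun=> 0).
  by have [b bD Eb] := descent_ind_expand (invfun_finv (fsW s sR)); exists b.
have Eab m : a m = \sum_(s in R) b s m.
  apply/eqP; rewrite -subr_eq0; apply/eqP; move: m.
  apply: descent_ind_free; rewrite (eq_bigr (fun m =>
    a m *: descent_ind m - \sum_(s in R) b s m *: descent_ind m)); last first.
    by move=> m _; rewrite scalerBl scaler_suml.
  rewrite sumrB -Ea Ef exchange_big /=; apply/eqP; rewrite subr_eq0; apply/eqP.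
  by apply: eq_bigr => s sR; case: (bP s sR).
have aR m : a m != 0 -> exists2 s, s \in R & descents m \subset S :\ s.
  move=> am; have [s /andP[sR bs]|b0] := pickP (fun s => (s \in R) && (b s m != 0)).
    by exists s => //; have [bD _] := bP s sR; apply: bD.
  case/eqP: am; rewrite Eab big1 // => s sR; apply/eqP; move: (b0 s).
  by rewrite sR => /negbFE.
pose sel m := [pick s in R | descents m \subset S :\ s].
pose h s := \sum_(m | sel m == Some s) a m *: descent_ind m.
have hE s m m' : agree (S :\ r :\ s) m m' -> h s m = h s m'.
  move=> agr; rewrite !sum_ffunE; apply: eq_bigr => m1; rewrite /sel.
  case: pickP => // s1 /andP[_ sD] /eqP[Es]; rewrite !ffunE.
  have [->|/aD sDr] := eqVneq (a m1) 0; first by rewrite !scale0r.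
  have {sD sDr} sD : descents m1 \subset S :\ r :\ s.
    by move: sD sDr; rewrite Es !subsetD1 => /andP[-> ->] /andP[_ ->].
  congr (_ *: _%:R); congr nat_of_bool.
  by apply/idP/idP; apply: agree_trans; [rewrite agree_sym|]; apply: agree_sub agr.
have Eh : f = \sum_(s in R) h s.
  rewrite Ea (bigID (fun m => a m == 0)) /= big1 ?add0r => [|m /eqP->]; last first.
    exact: scale0r.
  rewrite (partition_big (fun m => odflt r (sel m)) (mem R)) => [|m am]; last first.
    rewrite /sel; case: pickP => [s /andP[] //|no]; have [s sR sD] := aR m am.
    by have := no s; rewrite sR sD.
  apply: eq_bigr => s sR; rewrite /h [RHS](bigID (fun m => a m == 0)) /=.
  rewrite [X in _ = X + _]big1 ?add0r => [|m /andP[_ /eqP->]]; last exact: scale0r.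
  apply: eq_bigl => m; rewrite andbC; case am: (a m == 0); first by rewrite !andbF.
  rewrite !andbT /sel; case: pickP => [s1 _|no]; first by rewrite /= -(inj_eq Some_inj).
  by have [s2 sR2 sD2] := aR m (negbT am); have := no s2; rewrite sR2 sD2.
have G0 : #|G|%:R != 0 :> rat by rewrite pnatr_eq0 -lt0n cardG_gt0.
have -> : f = \sum_(s in R)
    (#|G|%:R : rat)^-1 *: ([ffun m => \sum_(g in G) h s (to m g)] : chainfun).
  apply/ffunP=> m; rewrite sum_ffunE.
  rewrite (eq_bigr (fun s => #|G|%:R^-1 * \sum_(g in G) h s (to m g))); last first.
    by move=> s _; rewrite !ffunE.
  rewrite -mulr_sumr exchange_big /=.
  rewrite (eq_bigr (fun=> f m)) => [|g gG]; last first.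
    rewrite -sum_ffunE -Eh; apply: (invfunP _ _ fr).
    by rewrite oagree_sym; apply: oagree_act gG (agree_refl _ _).
  have meanE (x : rat) : x = #|G|%:R^-1 * (x *+ #|G|) by rewrite -[x *+ _]mulr_natl mulKf.
  by rewrite sumr_const; apply: meanE.
apply: memv_suml => s sR; apply: memvZ; apply: (subvP (sumv_sup s sR (subvv _))).
exact: orbit_mean (hE s).
Qed.

Lemma lower_sub S R : (lower S R <= invfun S)%VS.
Proof. by apply/subv_sumP=> s _; apply/invfun_sub/subD1set. Qed.

Lemma dim_lower S R : R \subset S ->
  (\dim (invfun S))%:Z - (\dim (lower S R))%:Z =
  \sum_(U : {set I} | U \subset R) (-1) ^+ #|U| * (\dim (invfun (S :\: U)))%:Z.
Proof.
have [k] := ubnP #|R|; elim: k => // k IHk in S R *; rewrite ltnS => leR sRS.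
have [->|[r rR]] := set_0Vmem R.
  rewrite /lower big_set0 dimv0 subr0 (big_pred1 set0) => [|U]; last exact: subset0.
  by rewrite cards0 mul1r setD0.
have [rS ltR] : r \in S /\ (#|R :\ r| < k)%N.
  by rewrite (subsetP sRS) // -ltnS; move: leR; rewrite (cardsD1 r R) rR.
have sR'S : R :\ r \subset S :\ r by rewrite setSD.
have sR'S0 : R :\ r \subset S := subset_trans (subD1set _ _) sRS.
have Elow : lower S R = (invfun (S :\ r) + lower S (R :\ r))%VS.
  by rewrite /lower (big_setD1 r).
have := dimv_sum_cap (invfun (S :\ r)) (lower S (R :\ r)).
rewrite -Elow lower_cap => /(congr1 Posz); rewrite !PoszD => Edim.
rewrite (bigID (fun U : {set I} => r \in U)) /= addrC.
rewrite [X in _ = X + _](eq_bigl (fun U : {set I} => U \subset R :\ r)); last first.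
  by move=> U; rewrite subsetD1.
rewrite -IHk // [X in _ = _ + X](reindex_onto (fun U => r |: U) (fun U => U :\ r)) /=;
  last by move=> U /andP[_ rU]; rewrite setD1K.
rewrite [X in _ = _ + X](eq_big (fun U : {set I} => U \subset R :\ r)
  (fun U => - ((-1) ^+ #|U| * (\dim (invfun (S :\ r :\: U)))%:Z))).
- by rewrite sumrN -IHk //; lia.
- move=> U; rewrite setU11 andbT subUset sub1set rR subsetD1 /=.
  case sUR: (U \subset R) => //=; apply/eqP/idP => [<-|rU]; first by rewrite setD11.
  by apply: setU1K.
move=> U /andP[_ /eqP Er]; have rU : r \notin U by rewrite -Er setD11.
by rewrite cardsU1 rU exprS mulN1r mulNr setDDl.
Qed.

Lemma orbit_ind_oagree T m m' : oagree T m m' -> orbit_ind T m = orbit_ind T m'.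
Proof. by move=> h; apply/ffunP=> m1; rewrite !ffunE (oagree_congr m1 h). Qed.

Lemma orbit_ind_step S s m (U : {vspace chainfun}) :
    s \in S -> (lower S S <= U)%VS ->
    (forall m', agree (S :\ s) m' m -> orbit_ind S m' \in U \/ oagree S m m') ->
  orbit_ind S m \in U.
Proof.
move=> sS sNU stepU; pose h := orbit_ind (S :\ s) m - orbit_ind S m.
have sW : (invfun (S :\ s) <= invfun S)%VS by apply/invfun_sub/subD1set.
have hW : h \in invfun S.
  by apply: memvB; [apply: (subvP sW)|]; apply: orbit_ind_in.
have indU : orbit_ind (S :\ s) m \in U.
  by apply/(subvP sNU)/(subvP (sumv_sup s sS (subvv _)))/orbit_ind_in.
suff hU : h \in U by rewrite -[orbit_ind S m](subKr (orbit_ind (S :\ s) m)) memvB.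
rewrite (sum_orbit_ind (invfunP _ _ hW)); apply: memv_suml => m' _.
have [->|hm'] := eqVneq (h m') 0; first by rewrite mul0r scale0r mem0v.
apply: memvZ; move: hm'; rewrite !ffunE.
case off: (oagree S m m').
  by rewrite (oagree_sub (subD1set _ _) off) subrr eqxx.
case/boolP: (oagree _ m m') => [|_]; last by rewrite subrr eqxx.
case/exists_inP=> g gG agr _; pose m1 := to m' g^-1%g.
have m'm1 : oagree S m' m1.
  by apply: (@oagree_act S m' _ g^-1%g); rewrite ?groupV ?agree_refl.
have [|m1U|mm1] := stepU m1.
- by rewrite /m1 agree_sym -{1}[m](actK to g); apply: agree_act.
- by rewrite (orbit_ind_oagree m'm1).
by rewrite (oagree_trans mm1) // oagree_sym in off.
Qed.

End RankSelection.

(** * Set partitions and maximal chains *)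

Section Partitions.

Variable n : nat.
Implicit Types (x y z : {set {set 'I_n}}) (i j a b : 'I_n) (g : 'S_n).

Definition same x i j := j \in pblock x i.

Lemma same_refl x i : x \in setpart n -> same x i i.
Proof. by rewrite inE /same mem_pblock => /and3P[/eqP -> _ _]. Qed.

Lemma same_pblock x i j : x \in setpart n -> same x i j = (pblock x i == pblock x j).
Proof.
rewrite inE => /and3P[/eqP covx triv _].
by rewrite eq_pblock // covx inE.
Qed.

Lemma same_sym x i j : x \in setpart n -> same x i j = same x j i.
Proof. by move=> xP; rewrite !same_pblock // eq_sym. Qed.

Lemma same_trans x i j k :
  x \in setpart n -> same x i j -> same x j k -> same x i k.
Proof. by move=> xP; rewrite !same_pblock // => /eqP->. Qed.

Lemma same_congr x i j k : x \in setpart n -> same x i j -> same x i k = same x j k.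
Proof. by move=> xP; rewrite !same_pblock // => /eqP->. Qed.

Lemma pblock_part x i : x \in setpart n -> pblock x i \in x.
Proof. by rewrite inE => /and3P[/eqP covx _ _]; rewrite pblock_mem // covx inE. Qed.

Lemma pblock_def x B i : x \in setpart n -> B \in x -> i \in B -> pblock x i = B.
Proof. by rewrite inE => /and3P[_ triv _]; apply: def_pblock. Qed.

Lemma block_nonempty x B : x \in setpart n -> B \in x -> exists i, i \in B.
Proof.
rewrite inE => /and3P[_ _ x0] Bx; apply/set0Pn; apply: contraNneq x0.
by move=> <-.
Qed.

Lemma refinesP x y : x \in setpart n -> y \in setpart n ->
  reflect (forall i j, same x i j -> same y i j) (refines x y).
Proof.
move=> xP yP; apply: (iffP forall_inP) => [xy i j ij|xy B Bx].
  have /exists_inP[C Cy /subsetP sBC] := xy _ (pblock_part i xP).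
  by rewrite /same (pblock_def yP Cy) ?sBC // [_ \in _]same_refl.
have [i iB] := block_nonempty xP Bx; apply/exists_inP; exists (pblock y i).
  exact: pblock_part.
by apply/subsetP=> j jB; apply: xy; rewrite /same (pblock_def xP Bx iB).
Qed.

Lemma refines_refl x : x \in setpart n -> refines x x.
Proof. by move=> xP; apply/refinesP. Qed.

Lemma refines_trans x y z :
    x \in setpart n -> y \in setpart n -> z \in setpart n ->
  refines x y -> refines y z -> refines x z.
Proof.
move=> xP yP zP /refinesP-/(_ xP yP) xy /refinesP-/(_ yP zP) yz.
by apply/refinesP=> // i j /xy/yz.
Qed.

Lemma same_inj x y : x \in setpart n -> y \in setpart n ->
  (forall i j, same x i j = same y i j) -> x = y.
Proof.
move=> xP yP xy; have sub u v : u \in setpart n -> v \in setpart n ->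
    (forall i j, same u i j = same v i j) -> u \subset v.
  move=> uP vP uv; apply/subsetP=> B Bu; have [i iB] := block_nonempty uP Bu.
  rewrite -(pblock_def uP Bu iB) (_ : pblock u i = pblock v i) ?pblock_part //.
  by apply/setP=> j; apply: uv.
by apply/eqP; rewrite eqEsubset !sub.
Qed.

Definition kerpart (T : eqType) (f : 'I_n -> T) := preim_partition f [set: 'I_n].

Lemma kerpart_setpart (T : eqType) (f : 'I_n -> T) : kerpart f \in setpart n.
Proof. by rewrite inE; apply: preim_partitionP. Qed.

Lemma same_kerpart (T : eqType) (f : 'I_n -> T) i j :
  same (kerpart f) i j = (f i == f j).
Proof.
rewrite /same /kerpart /preim_partition pblock_equivalence_partition ?inE //.
by split=> // /eqP ->.
Qed.

Definition blockmin x i : 'I_n := [arg min_(j < i | same x i j) j].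

Lemma blockminP x i : x \in setpart n ->
  same x i (blockmin x i) /\ forall j, same x i j -> (blockmin x i <= j)%N.
Proof.
move=> xP; rewrite /blockmin; case: arg_minnP => [|j ij min]; first exact: same_refl.
by split.
Qed.

Lemma same_blockmin x i : x \in setpart n -> same x i (blockmin x i).
Proof. by move/blockminP=> -/(_ i)[]. Qed.

Lemma blockmin_le x i j : x \in setpart n -> same x i j -> (blockmin x i <= j)%N.
Proof. by move/blockminP=> -/(_ i)[_]; apply. Qed.

Lemma same_blockminE x i j :
  x \in setpart n -> same x i j = (blockmin x i == blockmin x j).
Proof.
move=> xP; apply/idP/eqP=> [ij|Eij]; last first.
  by apply: (same_trans xP (same_blockmin i xP)); rewrite Eij same_sym ?same_blockmin.
apply/val_inj/anti_leq/andP; split; apply: blockmin_le => //.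
  exact: same_trans ij (same_blockmin j xP).
by apply: same_trans (same_blockmin i xP) => //; rewrite same_sym.
Qed.

Lemma blockmin_id x i : x \in setpart n -> blockmin x (blockmin x i) = blockmin x i.
Proof. by move=> xP; apply/eqP; rewrite eq_sym -same_blockminE ?same_blockmin. Qed.

Definition mins x : {set 'I_n} := [set i | blockmin x i == i].

Lemma blockmin_mins x i : x \in setpart n -> blockmin x i \in mins x.
Proof. by move=> xP; rewrite inE blockmin_id. Qed.

Lemma minsE x i : x \in setpart n ->
  (i \in mins x) = [forall j, same x i j ==> (i <= j)%N].
Proof.
move=> xP; rewrite inE; apply/eqP/forall_inP=> [<- j|le_i].
  by rewrite -(same_congr _ xP (same_blockmin i xP)); apply: blockmin_le.
apply/val_inj/anti_leq; rewrite blockmin_le ?same_refl //=.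
exact/le_i/same_blockmin.
Qed.

Lemma same_mins x i j :
  x \in setpart n -> i \in mins x -> j \in mins x -> same x i j -> i = j.
Proof. by move=> xP; rewrite !inE same_blockminE // => /eqP-> /eqP-> /eqP. Qed.

Lemma card_mins x : x \in setpart n -> #|mins x| = #|x|.
Proof.
move=> xP; rewrite -[LHS](card_in_imset (f := pblock x)); last first.
  by move=> i j im jm /eqP; rewrite -same_pblock //; apply: same_mins.
congr #|pred_of_set _|; apply/setP=> B; apply/imsetP/idP=> [[i _ ->]|Bx].
  exact: pblock_part.
have [i iB] := block_nonempty xP Bx; exists (blockmin x i).
  exact: blockmin_mins.
apply/esym/(pblock_def xP Bx); rewrite -(pblock_def xP Bx iB).
exact: same_blockmin.
Qed.

Lemma rank_mins x : x \in setpart n -> rank_part x = #|~: mins x|.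
Proof. by move=> xP; rewrite cardsCs setCK card_ord card_mins. Qed.

Lemma mins_sub x y : x \in setpart n -> y \in setpart n ->
  refines x y -> mins y \subset mins x.
Proof.
move=> xP yP /refinesP-/(_ xP yP) xy; apply/subsetP=> i; rewrite !minsE //.
by move/forall_inP=> le_i; apply/forall_inP=> j /xy; apply: le_i.
Qed.

Lemma leq_rank x y : x \in setpart n -> y \in setpart n ->
  refines x y -> (rank_part x <= rank_part y)%N.
Proof.
move=> xP yP xy; rewrite !rank_mins //; apply: subset_leq_card.
by rewrite setCS mins_sub.
Qed.

Lemma refines_eq x y : x \in setpart n -> y \in setpart n ->
  refines x y -> rank_part x = rank_part y -> x = y.
Proof.
move=> xP yP xy Er; have /eqP Em : mins y == mins x.
  rewrite eqEcard mins_sub //= -(leq_add2r #|~: mins x|) cardsC.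
  by rewrite -rank_mins // Er rank_mins // cardsC.
have Eb i : blockmin y i = blockmin x i.
  have /eqP -> : blockmin y i == blockmin y (blockmin x i).
    by rewrite -same_blockminE //; apply: (refinesP _ _ xy) => //; apply: same_blockmin.
  by apply/eqP; have := blockmin_mins i xP; rewrite -Em inE.
by apply: same_inj => // i j; rewrite !same_blockminE // !Eb.
Qed.

Definition glue x a b : {set {set 'I_n}} :=
  kerpart (fun i => if same x i a then blockmin x b else blockmin x i).

Lemma glue_setpart x a b : glue x a b \in setpart n.
Proof. exact: kerpart_setpart. Qed.

Lemma same_glue x a b i j : x \in setpart n ->
  same (glue x a b) i j =
    [|| same x i j, same x i a && same x j b | same x i b && same x j a].
Proof.
move=> xP; rewrite same_kerpart; case: (boolP (same x i a)) => ia; case: (boolP (same x j a)) => ja.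
- by rewrite eqxx (same_congr j xP ia) same_sym ?ja.
- rewrite -same_blockminE // andbF orbF same_sym //=; case: (boolP (same x i j)) => //.
  by move=> ij; rewrite -(same_congr a xP ij) ia in ja.
- rewrite -same_blockminE // andbT /= orbC; case: (boolP (same x i b)) => //= _.
  by case: (boolP (same x i j)) => // ij; rewrite (same_congr a xP ij) ja in ia.
by rewrite -same_blockminE // andbF !orbF.
Qed.

Lemma glueC x a b : x \in setpart n -> glue x a b = glue x b a.
Proof.
move=> xP; apply: same_inj (glue_setpart _ _ _) (glue_setpart _ _ _) _ => i j.
by rewrite !same_glue //; congr (_ || _); rewrite orbC.
Qed.

Lemma refines_glue x a b : x \in setpart n -> refines x (glue x a b).
Proof.
move=> xP; apply/refinesP=> // [|i j ij]; first exact: glue_setpart.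
by rewrite same_glue // ij.
Qed.

Lemma glue_refines x y a b : x \in setpart n -> y \in setpart n ->
  refines x y -> same y a b -> refines (glue x a b) y.
Proof.
move=> xP yP /refinesP-/(_ xP yP) xy ab.
apply/refinesP=> // [|i j]; first exact: glue_setpart.
rewrite same_glue // => /or3P[/xy // | /andP[/xy ia /xy jb] | /andP[/xy ib /xy ja]].
  by apply: same_trans (same_trans yP ia ab) _ => //; rewrite same_sym.
by rewrite same_sym //; apply: same_trans (same_trans yP ja ab) _; rewrite // same_sym.
Qed.

Lemma mins_glue x a b : x \in setpart n ->
  (blockmin x b < blockmin x a)%N -> mins (glue x a b) = mins x :\ blockmin x a.
Proof.
move=> xP lt_ba; have mP := glue_setpart x a b.
apply/setP=> i; rewrite in_setD1 !minsE //.
apply/forall_inP/andP=> [le_i|[ia /forall_inP le_i] j].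
  split; last by apply/forall_inP=> j ij; apply: le_i; rewrite same_glue // ij.
  apply: contraTneq lt_ba => Ei; rewrite -leqNgt -Ei; apply: le_i.
  rewrite same_glue // Ei [same x (blockmin x a) a]same_sym //.
  by rewrite [same x (blockmin x b) b]same_sym // !same_blockmin // orbT.
rewrite same_glue // => /or3P[/le_i // | /andP[ia' jb] | /andP[ib ja]].
  case/eqP: ia; apply/val_inj/anti_leq.
  rewrite le_i ?(same_trans xP ia' (same_blockmin a xP)) //=.
  by apply: blockmin_le => //; rewrite same_sym.
apply: leq_trans (le_i _ (same_trans xP ib (same_blockmin b xP))) _.
by apply: leq_trans (ltnW lt_ba) _; apply: blockmin_le => //; rewrite same_sym.
Qed.

Lemma rank_glue x a b : x \in setpart n -> ~~ same x a b ->
  rank_part (glue x a b) = (rank_part x).+1.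
Proof.
move=> xP; wlog lt_ba : a b / (blockmin x b < blockmin x a)%N => [wl ab|].
  have [lt|lt|E] := ltngtP (blockmin x b) (blockmin x a); first exact: wl.
    by rewrite glueC // wl // same_sym.
  by rewrite same_blockminE // (val_inj E) eqxx in ab.
move=> _; rewrite !rank_mins ?glue_setpart // mins_glue //.
by rewrite setCD setUC cardsU1 inE blockmin_mins.
Qed.

Lemma cover_glue_blockmin x y a : x \in setpart n -> y \in setpart n ->
    refines x y -> rank_part y = (rank_part x).+1 ->
    a \in mins x -> a \notin mins y ->
  ~~ same x a (blockmin y a) /\ y = glue x a (blockmin y a).
Proof.
move=> xP yP xy Er ax ay; have nab : ~~ same x a (blockmin y a).
  apply: contra ay => /(same_mins xP) -> //; last first.
    exact/(subsetP (mins_sub xP yP xy))/blockmin_mins.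
  exact: blockmin_mins.
split=> //; apply/esym/refines_eq=> //; first exact: glue_setpart.
  by apply: glue_refines => //; apply: same_blockmin.
by rewrite rank_glue.
Qed.

Lemma cover_glue x y : x \in setpart n -> y \in setpart n ->
    refines x y -> rank_part y = (rank_part x).+1 ->
  exists a b, ~~ same x a b /\ y = glue x a b.
Proof.
move=> xP yP xy Er; have [a] : exists a, a \in mins x :\: mins y.
  apply/set0Pn; rewrite setD_eq0 -setCS; apply: contraTN (leqnn (rank_part y)) => sC.
  by rewrite {1}Er -ltnNge ltnS !rank_mins // subset_leq_card.
case/setDP=> ax ay; exists a, (blockmin y a); exact: cover_glue_blockmin.
Qed.

Lemma same_act x g i j : x \in setpart n ->
  same (part_action n x g) (g i) (g j) = same x i j.
Proof.
move=> xP; have blockE (B : {set 'I_n}) k : (g k \in block_action n B g) = (k \in B).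
  by rewrite /= setactE mem_imset //; apply: act_inj.
rewrite /same -[in RHS]blockE (@pblock_def _ (block_action n (pblock x i) g)) //.
- exact: setpart_act.
- exact/imset_f/pblock_part.
by rewrite blockE; apply: same_refl.
Qed.

Lemma rank_act x g : rank_part (part_action n x g) = rank_part x.
Proof. by rewrite /rank_part card_setact. Qed.

Lemma glue_act x g a b : x \in setpart n ->
  part_action n (glue x a b) g = glue (part_action n x g) (g a) (g b).
Proof.
move=> xP; have xgP := setpart_act g xP.
apply: same_inj; rewrite ?setpart_act ?glue_setpart // => i j.
rewrite -[i](permKV g) -[j](permKV g) same_glue // !same_act ?glue_setpart //.
by rewrite same_glue.
Qed.

Lemma part0E : part0 n = kerpart id.
Proof.
apply/setP=> B; apply/imsetP/imsetP=> -[i _ ->]; exists i; rewrite ?inE //.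
  by apply/setP=> j; rewrite !inE eq_sym.
by apply/setP=> j; rewrite !inE eq_sym.
Qed.

Lemma part0_setpart : part0 n \in setpart n.
Proof. by rewrite part0E kerpart_setpart. Qed.

Lemma same_part0 i j : same (part0 n) i j = (i == j).
Proof. by rewrite part0E same_kerpart. Qed.

Lemma rank_part0 : rank_part (part0 n) = 0%N.
Proof.
rewrite rank_mins ?part0_setpart //; apply: eq_card0 => i.
rewrite !inE; apply/negbF; rewrite eq_sym -same_part0.
exact/same_blockmin/part0_setpart.
Qed.

Lemma part0_refines x : x \in setpart n -> refines (part0 n) x.
Proof.
move=> xP; apply/refinesP=> // [|i j]; first exact: part0_setpart.
by rewrite same_part0 => /eqP <-; apply: same_refl.
Qed.

Lemma rank0_part0 x : x \in setpart n -> rank_part x = 0%N -> x = part0 n.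
Proof.
move=> xP x0; apply/esym/refines_eq; rewrite ?part0_setpart ?part0_refines //.
by rewrite rank_part0.
Qed.

End Partitions.

Section MaximalChains.

Variable N : nat.
Notation n := N.+1.
Implicit Types (x y z : {set {set 'I_n}}) (i j a b : 'I_n) (g : 'S_n).

Lemma part1_setpart : part1 n \in setpart n.
Proof.
rewrite inE /partition /part1 cover1 eqxx trivIset1 inE eq_sym -card_gt0.
by rewrite cardsT card_ord.
Qed.

Lemma same_part1 i j : same (part1 n) i j.
Proof. by rewrite /same (pblock_def part1_setpart (B := setT)) ?inE. Qed.

Lemma rank_part1 : rank_part (part1 n) = N.
Proof. by rewrite /rank_part /part1 cards1 subn1. Qed.

Lemma refines_part1 x : x \in setpart n -> refines x (part1 n).
Proof.
move=> xP; apply/refinesP=> // [|i j _]; first exact: part1_setpart.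
exact: same_part1.
Qed.

Lemma rank_le x : x \in setpart n -> (rank_part x <= N)%N.
Proof.
move=> xP; have := leq_rank xP part1_setpart (refines_part1 xP).
by rewrite rank_part1.
Qed.

Lemma rankN_part1 x : x \in setpart n -> rank_part x = N -> x = part1 n.
Proof.
by move=> xP xN; apply: refines_eq; rewrite ?part1_setpart ?refines_part1 ?rank_part1.
Qed.

Definition is_maxchain (m : {ffun 'I_n -> {set {set 'I_n}}}) :=
  [forall r : 'I_n, (m r \in setpart n) && (rank_part (m r) == r)]
  && [forall r : 'I_n, forall s : 'I_n, (r <= s)%N ==> refines (m r) (m s)].

Definition maxchain := {m | is_maxchain m}.
Implicit Types m : maxchain.

Definition lev m (r : 'I_n) := val m r.
Definition lvl m (k : nat) := val m (inord k).

Lemma lev_setpart m r : lev m r \in setpart n.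
Proof. by have /andP[/forallP/(_ r)/andP[]] := valP m. Qed.

Lemma lvl_setpart m k : lvl m k \in setpart n.
Proof. exact: lev_setpart. Qed.

Lemma rank_lev m r : rank_part (lev m r) = r.
Proof. by have /andP[/forallP/(_ r)/andP[_ /eqP]] := valP m. Qed.

Lemma rank_lvl m k : (k <= N)%N -> rank_part (lvl m k) = k.
Proof. by move=> kN; rewrite -[RHS](@inordK N) ?ltnS // -(rank_lev m). Qed.

Lemma lev_lvl m (r : 'I_n) : lev m r = lvl m r.
Proof. by rewrite /lvl inord_val. Qed.

Lemma lvl_refines m (j k : nat) : (j <= k <= N)%N -> refines (lvl m j) (lvl m k).
Proof.
case/andP=> jk kN; have /andP[_ /forallP/(_ (inord j))/forall_inP] := valP m.
by apply; rewrite !inordK // ltnS // (leq_trans jk).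
Qed.

Lemma lvl0 m : lvl m 0 = part0 n.
Proof. by apply: rank0_part0; [exact: lvl_setpart | exact: rank_lvl]. Qed.

Lemma lvlN m : lvl m N = part1 n.
Proof. by apply: rankN_part1; [exact: lvl_setpart | exact: rank_lvl]. Qed.

Lemma lvl_cover m k : (k < N)%N ->
  exists a b, ~~ same (lvl m k) a b /\ lvl m k.+1 = glue (lvl m k) a b.
Proof.
move=> kN; apply: cover_glue; first exact: lvl_setpart; first exact: lvl_setpart.
  by apply: lvl_refines; rewrite leqnSn.
by rewrite !rank_lvl // ltnW.
Qed.

Lemma maxchain_subst m k y : (0 < k < N)%N -> y \in setpart n -> rank_part y = k ->
    refines (lvl m k.-1) y -> refines y (lvl m k.+1) ->
  exists m', lvl m' k = y /\ forall r : 'I_n, r != k :> nat -> lev m' r = lev m r.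
Proof.
move=> /andP[k0 kN] yP yk ly yu.
pose f := [ffun r : 'I_n => if r == k :> nat then y else lev m r].
have fmax : is_maxchain f.
  apply/andP; split; apply/forallP=> r.
    by rewrite ffunE; case: eqP => [->|_]; rewrite ?yP ?yk ?eqxx ?lev_setpart ?rank_lev ?eqxx.
  apply/forallP=> s; apply/implyP=> rs; rewrite !ffunE.
  case: eqP => [Er|nr]; case: eqP => [Es|ns].
  - exact: refines_refl.
  - apply: refines_trans yu _; rewrite ?lvl_setpart ?lev_setpart // lev_lvl.
    by apply: lvl_refines; rewrite leq_ord andbT; lia.
  - apply: refines_trans ly; rewrite ?lvl_setpart ?lev_setpart // lev_lvl.
    by apply: lvl_refines; lia.
  by rewrite !lev_lvl; apply: lvl_refines; rewrite rs leq_ord.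
exists (Sub f fmax); split=> [|r rk].
  by rewrite /lvl SubK ffunE inordK ?eqxx // ltnS ltnW.
by rewrite /lev SubK ffunE (negPf rk).
Qed.

Lemma maxchain_extend (C : {set {set {set 'I_n}}}) :
    C \subset setpart n -> (forall x y, x \in C -> y \in C -> refines x y || refines y x) ->
  exists m, forall x, x \in C -> lvl m (rank_part x) = x.
Proof.
move=> /subsetP CP Ccmp.
pose inv k x := [&& x \in setpart n, rank_part x == k & [forall u in C,
  ((rank_part u <= k)%N ==> refines u x) && ((k <= rank_part u)%N ==> refines x u)]].
have inv0 : inv 0%N (part0 n).
  rewrite /inv part0_setpart rank_part0 eqxx; apply/forall_inP=> u uC /=.
  rewrite part0_refines ?CP // andbT leqn0; apply/implyP=> /eqP u0.
  by rewrite (rank0_part0 (CP u uC) u0) refines_refl ?part0_setpart.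
have step k x : (k < N)%N -> inv k x -> exists x', inv k.+1 x' && refines x x'.
  move=> kN /and3P[xP /eqP xk /forall_inP xC].
  pose P y := (y \in part1 n |: C) && (k < rank_part y)%N.
  have P1 : P (part1 n) by rewrite /P setU11 rank_part1.
  case: (arg_minnP (@rank_part n) P1) => y /andP[yC1 ky] miny.
  have yP : y \in setpart n.
    by move: yC1; rewrite in_setU1 => /predU1P[->|/CP //]; apply: part1_setpart.
  have xy : refines x y.
    move: yC1; rewrite in_setU1 => /predU1P[->|yC]; first exact: refines_part1.
    by have /andP[_] := xC y yC; rewrite (ltnW ky).
  have yu u : u \in C -> (k < rank_part u)%N -> refines y u.
    move=> uC ku; have uP := CP u uC; move: yC1; rewrite in_setU1.
    have le_yu : (rank_part y <= rank_part u)%N by apply: miny; rewrite /P setU1r.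
    case/predU1P=> [Ey|yC].
      by rewrite (@rankN_part1 u) // -?Ey ?refines_refl //; move: le_yu (rank_le uP);
        rewrite Ey rank_part1; lia.
    have /orP[//|uy] := Ccmp y u yC uC.
    rewrite (@refines_eq _ u y) ?refines_refl //; apply/eqP.
    by rewrite eqn_leq le_yu leq_rank.
  have [a [b [yab xab]]] : exists a b, same y a b /\ ~~ same x a b.
    case: (pickP (fun p : 'I_n * 'I_n => same y p.1 p.2 && ~~ same x p.1 p.2)).
      by move=> [a b] /andP[]; exists a, b.
    move=> no; have Exy : x = y.
      apply: same_inj => // i j; apply/idP/idP; first exact: (refinesP _ _ xy).
      by move=> ij; have := no (i, j); rewrite /= ij => /negbFE.
    by rewrite -xk Exy ltnn in ky.
  exists (glue x a b); rewrite refines_glue // andbT /inv glue_setpart.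
  rewrite rank_glue // xk eqxx; apply/forall_inP=> u uC; apply/andP; split.
    apply/implyP; rewrite leq_eqVlt => /predU1P[uk|].
      have mu : refines (glue x a b) u.
        by apply: (refines_trans _ yP _ _ (yu u uC _)); rewrite ?glue_setpart ?CP ?uk ?glue_refines.
      rewrite (@refines_eq _ (glue x a b) u) ?refines_refl ?glue_setpart ?CP //.
      by rewrite rank_glue // xk.
    rewrite ltnS => uk; have /andP[] := xC u uC; rewrite uk /= => ux _.
    by apply: (refines_trans _ xP _ ux (refines_glue _ _ xP)); rewrite ?glue_setpart ?CP.
  apply/implyP=> uk; apply: (refines_trans _ yP _ _ (yu u uC uk)); rewrite ?glue_setpart ?CP //.
  exact: glue_refines.
pose nxt k x := odflt x [pick x' | inv k.+1 x' && refines x x'].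
pose f := fix f k := if k is k'.+1 then nxt k' (f k') else part0 n.
have fS k : f k.+1 = nxt k (f k) by [].
have finv k : (k <= N)%N -> inv k (f k).
  elim: k => [//|k IHk] kN; rewrite fS /nxt; case: pickP => [x' /andP[] //|no].
  by have [x' x'P] := step k _ kN (IHk (ltnW kN)); have := no x'; rewrite x'P.
have fP k : (k <= N)%N -> f k \in setpart n by move/finv=> /and3P[].
have fref k d : (k + d <= N)%N -> refines (f k) (f (k + d)%N).
  elim: d => [|d IHd] kdN; first by rewrite addn0 in kdN *; rewrite refines_refl ?fP.
  have kd : (k + d <= N)%N by rewrite addnS in kdN; apply: ltnW.
  apply: refines_trans (IHd kd) _; rewrite ?fP //; first by apply: leq_trans kd; rewrite leq_addr.
  rewrite addnS fS /nxt; case: pickP => [x' /andP[] //|_]; exact/refines_refl/fP.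
have fmax : is_maxchain [ffun r : 'I_n => f r].
  have rN (r : 'I_n) : (r <= N)%N by rewrite -ltnS.
  apply/andP; split; apply/forallP=> r.
    by have /and3P[] := finv r (rN r); rewrite ffunE => -> ->.
  by apply/forallP=> s; apply/implyP=> rs; rewrite !ffunE -(subnKC rs) fref // subnKC.
exists (Sub _ fmax) => x xC; have xN := rank_le (CP x xC).
rewrite /lvl SubK ffunE inordK //; have /and3P[fxP /eqP fx /forall_inP/(_ x xC)] := finv _ xN.
by rewrite leqnn /= => /andP[_ fxx]; apply: refines_eq => //; apply: CP.
Qed.

End MaximalChains.

(** * Increasing chains *)

Section EdgeLabelling.

Variable N : nat.
Notation n := N.+1.
Implicit Types (x y z : {set {set 'I_n}}) (i j a b c : 'I_n) (m : maxchain N).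

Definition key m := (\sum_(r : 'I_n) \sum_(i in ~: mins (lev m r)) i)%N.

Notation locmin := (locmin (@lev N) key).

Lemma lvl_mins_sub m (j k : nat) :
  (j <= k <= N)%N -> mins (lvl m k) \subset mins (lvl m j).
Proof. by move=> jk; rewrite mins_sub ?lvl_setpart ?lvl_refines. Qed.

Lemma card_mins_lvl m k : (k <= N)%N -> #|mins (lvl m k)| = (n - k)%N.
Proof.
move=> kN; rewrite cardsCs card_ord -rank_mins ?lvl_setpart //.
by rewrite rank_lvl.
Qed.

Lemma mins_lvlS m k a : (k < N)%N -> a \in mins (lvl m k) :\: mins (lvl m k.+1) ->
  mins (lvl m k.+1) = mins (lvl m k) :\ a.
Proof.
move=> kN /setDP[ak aS]; apply/eqP; rewrite eqEcard.
rewrite subsetD1 aS lvl_mins_sub ?leqnSn ?kN //=.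
have := cardsD1 a (mins (lvl m k)).
rewrite ak (card_mins_lvl m kN) (card_mins_lvl m (ltnW kN)) add1n => E.
by rewrite -ltnS -E; lia.
Qed.

Lemma label_exists m k : (k < N)%N ->
  exists a, a \in mins (lvl m k) :\: mins (lvl m k.+1).
Proof.
move=> kN; apply/set0Pn; rewrite setD_eq0; apply/negP=> /subset_leq_card.
by rewrite (card_mins_lvl m kN) (card_mins_lvl m (ltnW kN)); lia.
Qed.

(* Otherwise exchanging the two merges decreases the key. *)
Lemma locmin_increasing (T : {set 'I_n}) m k a c :
    locmin T m -> (k.+1 < N)%N -> inord k.+1 \notin T ->
    a \in mins (lvl m k) :\: mins (lvl m k.+1) ->
    c \in mins (lvl m k.+1) :\: mins (lvl m k.+2) ->
  (a < c)%N.
Proof.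
move=> locm kN kT aL cL; rewrite ltnNge; apply/negP=> le_ca.
have Ek1 := mins_lvlS (ltnW kN) aL; move: aL cL => /setDP[ax ay] /setDP[cy cz].
have lt_ca : (c < a)%N.
  by rewrite ltn_neqAle le_ca andbT; apply: contraNneq ay => /val_inj <-.
set x := lvl m k in Ek1 ax; set z := lvl m k.+2 in cz.
have xP : x \in setpart n := lvl_setpart _ _.
have zP : z \in setpart n := lvl_setpart _ _.
have kN1 := ltnW kN; have kN0 := ltnW kN1.
have xz : refines x z by apply: lvl_refines; rewrite kN andbT; lia.
have cx : c \in mins x by apply: subsetP cy; apply: lvl_mins_sub; rewrite leqnSn.
pose b := blockmin z c; have bx : b \in mins x.
  exact/(subsetP (mins_sub xP zP xz))/blockmin_mins.
have neq_bc : b != c by apply: contraNneq cz => <-; apply: blockmin_mins.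
have lt_bc : (b < c)%N by rewrite ltn_neqAle neq_bc blockmin_le ?same_refl.
have [Eb Ec] : blockmin x b = b /\ blockmin x c = c.
  by move: bx cx; rewrite !inE => /eqP-> /eqP->.
have xcb : ~~ same x c b by rewrite same_blockminE // Eb Ec eq_sym.
have cb : same z c b := same_blockmin c zP.
have yrk : rank_part (glue x c b) = k.+1 by rewrite rank_glue // rank_lvl.
have [|m' [m'k m'off]] := maxchain_subst (m := m) (k := k.+1) _
    (glue_setpart x c b) yrk (refines_glue c b xP) (glue_refines xP zP xz cb).
  by rewrite kN.
have Ek : (inord k.+1 : 'I_n) = k.+1 :> nat by rewrite inordK ?ltnS.
have := locm (inord k.+1) m' kT; rewrite /key.
rewrite (bigD1 (inord k.+1)) //= [X in (_ <= X)%N](bigD1 (inord k.+1)) //=.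
have -> : (\sum_(r < n | r != inord k.+1) \sum_(i in ~: mins (lev m' r)) i
         = \sum_(r < n | r != inord k.+1) \sum_(i in ~: mins (lev m r)) i)%N.
  apply: eq_bigr => r rk; rewrite m'off //; apply: contraNneq rk => rk.
  by apply/eqP/val_inj; rewrite /= rk Ek.
rewrite leq_add2r !lev_lvl Ek m'k mins_glue ?Eb ?Ec // Ek1.
rewrite !setCD ![_ :|: [set _]]setUC !big_setU1 ?in_setC ?negbK //= => le_key.
have /le_key : agree (@lev N) (~: [set inord k.+1]) m' m.
  apply/agreeP=> r; rewrite !inE => rk; apply: m'off.
  by apply: contraNneq rk => rk; apply/eqP/val_inj; rewrite /= rk Ek.
by rewrite leq_add2r leqNgt lt_ca.
Qed.

Lemma label_le (T : {set 'I_n}) m (k t : nat) a c :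
    locmin T m -> (k < t <= N)%N ->
    (forall j : nat, (k < j < t)%N -> inord j \notin T) ->
    a \in mins (lvl m k) :\: mins (lvl m k.+1) ->
    c \in mins (lvl m k) :\: mins (lvl m t) ->
  (a <= c)%N.
Proof.
move=> locm /andP[kt tN] jT aL; elim: t kt tN jT c => // t IHt.
rewrite ltnS leq_eqVlt => /predU1P[<- kN _ c cL|kt tN jT c /setDP[ck ct1]].
  move: (aL) cL => /(mins_lvlS kN) -> /setDP[ck]; rewrite in_setD1 ck andbT negbK.
  by move/eqP->.
have jT' (j : nat) : (k < j < t)%N -> inord j \notin T.
  by move=> /andP[kj jt]; apply: jT; rewrite kj ltnS ltnW.
have [ct|ct] := boolP (c \in mins (lvl m t)); last first.
  by apply: (IHt kt (ltnW tN) jT'); apply/setDP.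
case: t => // t in IHt kt tN jT jT' ct1 ct *.
have [b bL] := label_exists m (ltnW tN); apply: (@leq_trans b).
  apply: (IHt kt (ltnW tN) jT'); have /setDP[bt bt1] := bL.
  apply/setDP; split=> //; apply: subsetP bt; apply: lvl_mins_sub.
  by rewrite -ltnS kt ltnW // ltnW.
apply/ltnW/(locmin_increasing locm tN _ bL); last exact/setDP.
by apply: jT; rewrite kt ltnS leqnn.
Qed.

Lemma label_glue m k a : (k < N)%N -> a \in mins (lvl m k) :\: mins (lvl m k.+1) ->
  lvl m k.+1 = glue (lvl m k) a (blockmin (lvl m k.+1) a).
Proof.
move=> kN /setDP[ak aS].
case: (@cover_glue_blockmin _ (lvl m k) (lvl m k.+1) a); rewrite ?lvl_setpart //.
  by apply: lvl_refines; rewrite leqnSn.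
by rewrite !rank_lvl // ltnW.
Qed.

Lemma locmin_inj (T : {set 'I_n}) m m' :
  locmin T m -> locmin T m' -> agree (@lev N) T m m' -> m = m'.
Proof.
move=> locm locm' /agreeP agr.
suff eq_lvl (k : nat) : (k <= N)%N -> lvl m k = lvl m' k.
  apply/val_inj/ffunP=> r; have := eq_lvl r (leq_ord r).
  by rewrite -!lev_lvl.
elim: k => [|k IHk] kN; first by rewrite !lvl0.
have [kT|kT] := boolP (inord k.+1 \in T); first exact: agr.
have {IHk} Ek := IHk (ltnW kN).
have exP : exists t, (k < t)%N && ((inord t \in T) || (t == N)).
  by exists N; rewrite kN eqxx orbT.
case: (ex_minnP exP) => t /andP[kt tTN] mint.
have tN : (t <= N)%N by apply: mint; rewrite kN eqxx orbT.
have jT (j : nat) : (k < j < t)%N -> inord j \notin T.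
  case/andP=> kj; rewrite ltnNge; apply: contra => jT; apply: mint.
  by rewrite kj jT.
have Et : lvl m t = lvl m' t.
  by case/orP: tTN => [/agr //|/eqP->]; rewrite !lvlN.
have ktN : (k < t <= N)%N by rewrite kt.
have [a aL] := label_exists m kN; have [a' aL'] := label_exists m' kN.
have upto m1 b : b \in mins (lvl m1 k) :\: mins (lvl m1 k.+1) ->
    b \in mins (lvl m1 k) :\: mins (lvl m1 t).
  case/setDP=> bk bS; apply/setDP; split=> //; apply: contra bS; apply/subsetP.
  by apply: lvl_mins_sub; rewrite kt.
have Ea : a' = a.
  apply/val_inj/anti_leq/andP; split.
    by apply: (label_le locm' ktN jT aL'); rewrite -Et -Ek; apply: upto.
  by apply: (label_le locm ktN jT aL); rewrite Et Ek; apply: upto.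
rewrite {a'}Ea in aL'; rewrite (label_glue kN aL) (label_glue kN aL') -Ek.
congr (glue _ a _); pose b m1 := blockmin (lvl m1 k.+1) a; rewrite -!/(b _).
have bP m1 : a \in mins (lvl m1 k) :\: mins (lvl m1 k.+1) ->
    [/\ b m1 \in mins (lvl m1 k), (b m1 < a)%N & same (lvl m1 t) a (b m1)].
  have P1 := lvl_setpart m1 k.+1; case/setDP=> _ aS; split.
  - apply/(subsetP _ _ (blockmin_mins a P1))/lvl_mins_sub.
    by rewrite leqnSn.
  - rewrite ltn_neqAle blockmin_le ?same_refl // andbT.
    by apply: contraNneq aS => /val_inj E; rewrite -[X in X \in _]E blockmin_mins.
  apply: (refinesP P1 (lvl_setpart m1 t) _) (same_blockmin a P1).
  by apply: lvl_refines; rewrite kt.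
have [b1 b2 b3] := bP _ aL; have [] := bP _ aL'; rewrite -Ek -Et => b1' b2' b3'.
have tP := lvl_setpart m t.
have noLt (c c' : 'I_n) : c' \in mins (lvl m k) -> (c' < a)%N -> same (lvl m t) a c ->
    same (lvl m t) a c' -> ~~ (c < c')%N.
  move=> c'k c'a ac ac'; apply/negP=> lt_cc'.
  suff : (a <= c')%N by rewrite leqNgt c'a.
  apply: (label_le locm ktN jT aL).
  apply/setDP; split=> //; rewrite minsE //; apply/negP=> /forall_inP/(_ c).
  by rewrite leqNgt lt_cc' -(same_congr c tP ac') ac => /(_ isT).
by apply/val_inj/anti_leq/andP; split; rewrite leqNgt; apply: noLt.
Qed.

End EdgeLabelling.

Lemma leq_card_imset_fibers (aT rT1 rT2 : finType) (f : aT -> rT1) (h : aT -> rT2) :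
  (forall x y, h x = h y -> f x = f y) -> (#|[set f x | x : aT]| <= #|[set h x | x : aT]|)%N.
Proof.
move=> hf; rewrite -(card_imset _ set1_inj).
pose k y := [set f x | x in [pred x | h x == y]].
apply: leq_trans (leq_imset_card k _); apply: subset_leq_card.
apply/subsetP=> _ /imsetP[_ /imsetP[x _ ->] ->]; apply/imsetP; exists (h x).
  exact: imset_f.
apply/setP=> z; rewrite inE; apply/eqP/imsetP=> [->|[x' /eqP hx ->]].
  by exists x; rewrite ?inE.
exact: hf.
Qed.

Section YoungMultiplicity.

Variable n : nat.
Implicit Types (T S : {set 'I_n}) (g : 'S_n).

Definition norbits T := #|[set orbit (chain_action n) (young n) c | c in chains T]|.

Lemma alphaE T g : alpha T g = #|'Fix_(chains T | chain_action n)[g]|%:R.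
Proof.
rewrite cfunE in_setT mulr1n.
transitivity (\sum_(c in chains T) (chain_action n c g == c)%:R : algC).
  rewrite [RHS]big_enum_val; apply: eq_bigr => i _.
  by rewrite mxE.
rewrite -sum1_card natr_sum [LHS]big_mkcond [RHS]big_mkcond; apply: eq_bigr => c _.
rewrite in_setI; case: ifP => //= _; rewrite (sameP afix1P eqP).
by case: eqP.
Qed.

Lemma mult_alpha T : '['Res[young n] (alpha T), 1] = (norbits T)%:R.
Proof.
have sYT : young n \subset [set: 'S_n] by apply: subsetT.
rewrite cfdotE (eq_bigr (fun g => #|'Fix_(chains T | chain_action n)[g]|%:R)); last first.
  by move=> g gY; rewrite cfResE // alphaE cfun1E gY conjC1 mulr1.
have actsY : [acts young n, on chains T | chain_action n].
  exact: subset_trans sYT (acts_chains T).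
have FC : (\sum_(g in young n) #|'Fix_(chains T | chain_action n)[g]|)%N
    = (norbits T * #|young n|)%N := Frobenius_Cauchy actsY.
rewrite -natr_sum FC natrM mulrC mulfK ?neq0CG //.
Qed.

Lemma bprimeE S :
  bprime S = \sum_(T : {set 'I_n} | T \subset S) (-1) ^+ #|S :\: T| * (norbits T)%:R.
Proof.
rewrite /bprime /beta linear_sum cfdot_suml; apply: eq_bigr => T _.
by rewrite linearZ cfdotZl mult_alpha.
Qed.

End YoungMultiplicity.

Section ChainAction.

Variable N : nat.
Notation n := N.+1.
Implicit Types (m : maxchain N) (g : 'S_n) (S T : {set 'I_n}).

Lemma young_fix g : (g \in young n) = (g ord_max == ord_max).
Proof.
have ltP (i : 'I_n) : (i \in [set i : 'I_n | (i < n.-1)%N]) = (i != ord_max).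
  rewrite inE -val_eqE /=; have := ltn_ord i; rewrite ltnS leq_eqVlt.
  by case: ltngtP.
apply/idP/eqP=> [gY|gm].
  have := astabs_act ord_max gY; rewrite !ltP eqxx /= => /negbFE/eqP.
  by [].
rewrite /young /= inE in_setT inE; apply/subsetP=> i; rewrite ltP => i_max.
rewrite inE /= ltP; apply: contraNneq i_max => gi; apply/eqP/(@perm_inj _ g).
by rewrite gm.
Qed.

Lemma maxact_subproof m g : is_maxchain [ffun r => part_action n (lev m r) g].
Proof.
apply/andP; split; apply/forallP=> r.
  by rewrite ffunE setpart_act ?lev_setpart // rank_act rank_lev /=.
apply/forallP=> s; apply/implyP=> rs; rewrite !ffunE; apply: refines_act.
by rewrite !lev_lvl; apply: lvl_refines; rewrite rs leq_ord.
Qed.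

Definition maxact m g : maxchain N := Sub _ (maxact_subproof m g).

Lemma lev_maxact m g r : lev (maxact m g) r = part_action n (lev m r) g.
Proof. by rewrite /lev /= ffunE. Qed.

Lemma maxact1 m : maxact m 1 = m.
Proof. by apply/val_inj/ffunP=> r; rewrite /= ffunE act1. Qed.

Lemma maxactM m g h : maxact m (g * h)%g = maxact (maxact m g) h.
Proof.
apply/val_inj/ffunP=> r; rewrite -[LHS]/(lev _ r) -[RHS]/(lev _ r) !lev_maxact.
exact: actM.
Qed.

Definition max_action : {action 'S_n &-> maxchain N} := TotalAction maxact1 maxactM.

Lemma lev_act m m' r g :
  lev m r = lev m' r -> lev (max_action m g) r = lev (max_action m' g) r.
Proof. by rewrite /= !lev_maxact => ->. Qed.

Lemma lvl_act m g k : lvl (max_action m g) k = part_action n (lvl m k) g.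
Proof. exact: lev_maxact. Qed.

Notation oagree := (oagree (@lev N) (young n) max_action).

Definition restr T m := [set lev m r | r in T].

Lemma restr_act T m g : restr T (max_action m g) = chain_action n (restr T m) g.
Proof.
rewrite /restr [in RHS]/= setactE -imset_comp; apply: eq_imset => r /=.
exact: lev_maxact.
Qed.

Lemma restr_eq T m m' : (restr T m == restr T m') = agree (@lev N) T m m'.
Proof.
apply/eqP/agreeP=> [Em r rT|agr]; last exact: eq_in_imset.
have : lev m r \in restr T m' by rewrite -Em imset_f.
by case/imsetP=> s sT Es; rewrite Es -[r](_ : s = _) //;
  apply/val_inj; rewrite /= -(rank_lev m r) Es rank_lev.
Qed.

Lemma restr_chain T m : (forall r, r \in T -> (0 < r < N)%N) -> restr T m \in chains T.
Proof.
move=> TP; rewrite inE; apply/andP; split; last first.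
  apply/eqP/setP=> r; rewrite inE; apply/exists_inP/idP=> [[_ /imsetP[s sT ->]]|rT].
    by rewrite rank_lev => /eqP/val_inj <-.
  by exists (lev m r); [apply: imset_f | rewrite rank_lev].
apply/andP; split.
  apply/subsetP=> _ /imsetP[r rT ->]; rewrite in_setD lev_setpart andbT in_set2.
  have /andP[r0 rN] := TP r rT; apply/norP; split.
    by apply: contraTneq r0 => Er; rewrite -(rank_lev m r) Er rank_part0.
  by apply: contraTneq rN => Er; rewrite -(rank_lev m r) Er rank_part1 ltnn.
apply/forall_inP=> _ /imsetP[r rT ->]; apply/forall_inP=> _ /imsetP[s sT ->].
rewrite !lev_lvl; case/orP: (leq_total r s) => rs; apply/orP; [left|right].
  by apply: lvl_refines; rewrite rs leq_ord.
by apply: lvl_refines; rewrite rs leq_ord.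
Qed.

Lemma restr_onto T c : c \in chains T -> exists m, restr T m = c.
Proof.
rewrite inE => /andP[/andP[/subsetP cP /forall_inP cc] /eqP <-].
have cP' x : x \in c -> x \in setpart n by move/cP; rewrite in_setD => /andP[].
have [x y xc yc|m mP] := @maxchain_extend N c (introT subsetP cP').
  exact: (forall_inP (cc x xc)).
exists m; apply/setP=> x; apply/imsetP/idP=> [[r]|xc].
  rewrite inE => /exists_inP[y yc /eqP Er] ->.
  by rewrite lev_lvl -Er mP.
have xN := rank_le (cP' x xc); exists (inord (rank_part x)); last first.
  by rewrite lev_lvl inordK // mP.
by rewrite inE; apply/exists_inP; exists x; rewrite // inordK.
Qed.

Lemma oagree_orbit T m m' : oagree T m m' =
  (orbit (chain_action n) (young n) (restr T m)
     == orbit (chain_action n) (young n) (restr T m')).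
Proof.
rewrite (sameP eqP orbit_eqP); apply/exists_inP/orbitP=> -[g gY].
  rewrite -restr_eq restr_act => /eqP E; exists g^-1%g; first by rewrite groupV.
  by rewrite -E actK.
by move=> E; exists g^-1%g; rewrite ?groupV // -restr_eq restr_act -E actK.
Qed.

Lemma norbits_dim T : (forall r, r \in T -> (0 < r < N)%N) ->
  norbits T = \dim (invfun (@lev N) (young n) max_action T).
Proof.
move=> TP; rewrite dim_invfun; last exact: lev_act.
have -> : norbits T =
    #|[set orbit (chain_action n) (young n) (restr T m) | m : maxchain N]|.
  apply: eq_card => B; apply/imsetP/imsetP=> [[c cT ->]|[m _ ->]].
    by have [m <-] := restr_onto cT; exists m.
  by exists (restr T m); rewrite ?restr_chain.
apply/eqP; rewrite eqn_leq; apply/andP; split; apply: leq_card_imset_fibers => m m'.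
  move/setP/(_ m'); rewrite !inE oagree_refl oagree_orbit => /eqP.
  exact.
move/eqP; rewrite -oagree_orbit => h; apply/setP=> m1.
by rewrite !inE (oagree_congr lev_act m1 h).
Qed.

Lemma bprime_dim S : (forall r, r \in S -> (0 < r < N)%N) ->
  bprime S = (\dim (invfun (@lev N) (young n) max_action S))%:R
           - (\dim (lower (@lev N) (young n) max_action S S))%:R.
Proof.
move=> SP; have := dim_lower (young n) lev_act (@locmin_inj N) (subxx S).
move/(congr1 (intr : int -> algC)); rewrite rmorphB /= => ->.
rewrite rmorph_sum bprimeE (reindex_onto (fun U => S :\: U) (fun T => S :\: T)) /=.
  apply: eq_big => [U|U].
    rewrite subsetDl setDDr setDv set0U; apply/eqP/idP => [<-|/setIidPr //].
    exact: subsetIl.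
  rewrite subsetDl /= => /eqP E; rewrite rmorphM rmorphXn rmorphN1 E.
  rewrite norbits_dim // => r; rewrite inE => /andP[_]; exact: SP.
by move=> T sTS; rewrite setDDr setDv set0U; apply/setIidPr.
Qed.

End ChainAction.

(** * Signed sums over the bars of a path *)

Section LowerBound.

Variable N : nat.
Notation n := N.+1.
Implicit Types (i j : 'I_n) (A B : {set 'I_n}) (g s w : 'S_n) (m : maxchain N).

(* The bar [i] separates [i - 1] from [i] in the path 0, ..., N; the blocks of
   [path_part A] are the intervals left after removing the bars in [A]. *)
Definition path_part A := kerpart (fun i => #|[set k : 'I_n | (k <= i)%N && (k \notin A)]|).

Lemma path_part_setpart A : path_part A \in setpart n.
Proof. exact: kerpart_setpart. Qed.

Lemma same_path_part A i j : (i <= j)%N ->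
  same (path_part A) i j = [forall k : 'I_n, (i < k <= j)%N ==> (k \in A)].
Proof.
move=> ij; rewrite same_kerpart.
set X := [set k | _]; set Y := [set k | _].
have sXY : X \subset Y.
  by apply/subsetP=> k; rewrite !inE => /andP[ki ->]; rewrite (leq_trans ki).
apply/eqP/forall_inP=> [Ec k /andP[ik kj]|allA].
  apply/negPn/negP=> kA; have /eqP E : X == Y by rewrite eqEcard sXY Ec leqnn.
  by have := in_set (fun k : 'I_n => (k <= j)%N && (k \notin A)) k;
    rewrite -/Y -E !inE kA kj andbT leqNgt ik.
congr #|pred_of_set _|; apply/eqP; rewrite eqEsubset sXY /=.
apply/subsetP=> k; rewrite !inE => /andP[kj kA]; rewrite kA andbT leqNgt.
by apply: contra kA => ik; apply: allA; rewrite ik.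
Qed.

Lemma mins_path_part A : ord0 \notin A -> mins (path_part A) = ~: A.
Proof.
move=> A0; apply/setP=> i; rewrite minsE ?path_part_setpart // in_setC.
apply/forall_inP/idP=> [le_i|iA j].
  apply/negP=> iA; have i0 : (0 < i)%N.
    by rewrite lt0n; apply: contraNneq A0 => i0; rewrite (_ : ord0 = i) //; apply/val_inj.
  have iN : (i.-1 < n)%N by apply: leq_ltn_trans (ltn_ord i); apply: leq_pred.
  suff /le_i : same (path_part A) i (Ordinal iN) by rewrite leqNgt /= prednK // leqnn.
  rewrite same_sym ?path_part_setpart // same_path_part ?leq_pred //.
  apply/forall_inP=> k; rewrite /= prednK // => ki; suff -> : k = i by [].
  by apply/val_inj/eqP; rewrite eqn_leq andbC.
apply: contraTT; rewrite -ltnNge => ji.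
rewrite same_sym ?path_part_setpart // same_path_part ?(ltnW ji) //.
by apply/negP=> /forall_inP/(_ i); rewrite ji leqnn (negPf iA) => /(_ isT).
Qed.

Lemma rank_path_part A : ord0 \notin A -> rank_part (path_part A) = #|A|.
Proof. by move=> A0; rewrite rank_mins ?path_part_setpart // mins_path_part // setCK. Qed.

Lemma path_part_refines A B : A \subset B -> refines (path_part A) (path_part B).
Proof.
move=> /subsetP sAB.
have sub (k l : 'I_n) : (k <= l)%N -> same (path_part A) k l -> same (path_part B) k l.
  move=> kl; rewrite !same_path_part // => /forall_inP allA.
  by apply/forall_inP=> b /allA/sAB.
apply/refinesP; rewrite ?path_part_setpart // => i j.
case/orP: (leq_total i j) => ij; first exact: sub.
by rewrite same_sym ?path_part_setpart // => /(sub _ _ ij);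
  rewrite same_sym ?path_part_setpart.
Qed.

Definition marksize (x : {set {set 'I_n}}) := #|pblock x ord_max|.

Lemma marksize_act x g : x \in setpart n -> g \in young n ->
  marksize (part_action n x g) = marksize x.
Proof.
move=> xP; rewrite young_fix => /eqP gm; rewrite /marksize.
rewrite -(card_imset (pblock x _) (@perm_inj _ g)).
apply: eq_card => i; rewrite -[i \in _]/(same _ _ _) -{1}gm -[i](permKV g) same_act //.
by rewrite mem_imset //; apply: perm_inj.
Qed.

Lemma card_ord_ge (k : nat) : #|[set i : 'I_n | (k <= i)%N]| = (n - k)%N.
Proof.
rewrite -sum1_card (eq_bigl (fun i : 'I_n => true && (k <= i)%N)); last by move=> i; rewrite inE.
by rewrite -(big_geq_mkord k n xpredT (fun=> 1%N)) sum_nat_const_nat muln1.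
Qed.

Lemma marksize_path_part A (k : nat) : (k <= N)%N ->
  (k < marksize (path_part A))%N = ([set i : 'I_n | (N - k < i)%N] \subset A).
Proof.
move=> kN; have Ek : (n - (N - k))%N = k.+1 by rewrite subSn ?leq_subr // subKn.
apply/idP/idP=> [lt_k|/subsetP sA].
  apply/subsetP=> i; rewrite inE => ki; apply: contraLR lt_k => iA; rewrite -leqNgt.
  have -> : k = (n - (N - k).+1)%N by rewrite subSS subKn.
  rewrite -card_ord_ge; apply: subset_leq_card; apply/subsetP=> j.
  rewrite inE -[_ \in _]/(same _ _ _) same_sym ?path_part_setpart //.
  rewrite same_path_part ?leq_ord // => /forall_inP/(_ i); rewrite leq_ord andbT (negPf iA).
  rewrite ltnNge; case: (leqP i j) => [|_ /(_ isT)//] ij _.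
  exact: leq_trans ij.
rewrite -Ek -card_ord_ge; apply: subset_leq_card; apply/subsetP=> j.
rewrite inE -[_ \in _]/(same _ _ _) same_sym ?path_part_setpart // => kj.
rewrite same_path_part ?leq_ord //; apply/forall_inP=> i /andP[ji _].
by apply: sA; rewrite inE; apply: leq_ltn_trans ji.
Qed.

(* The bars removed after [r] steps when the bar [i] is removed at step [n - s i]. *)
Definition bars s (r : nat) := [set i : 'I_n | (N - r < s i)%N].

Lemma bars_inj s w : (forall r : 'I_n, bars s r = bars w r) -> s = w.
Proof.
move=> Esw; apply/permP=> i; apply/val_inj/anti_leq.
have half s1 s2 : (forall r : 'I_n, bars s1 r = bars s2 r) -> (s1 i <= s2 i)%N.
  move=> E; case Ei: (s1 i : nat) => [//|k].
  have kN : (k < n)%N by apply: ltn_trans (ltn_ord (s1 i)); rewrite Ei.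
  have /setP/(_ i) := E (inord (N - k)).
  by rewrite !inE inordK ?ltnS ?leq_subr // subKn // Ei leqnn => <-.
by rewrite !half.
Qed.

Lemma bars_sub s (k r : nat) : (k <= r)%N -> bars s k \subset bars s r.
Proof.
by move=> kr; apply/subsetP=> i; rewrite !inE; apply: leq_ltn_trans; rewrite leq_sub2l.
Qed.

Lemma card_bars s (r : nat) : (r <= N)%N -> #|bars s r| = r.
Proof.
move=> rN; have -> : bars s r = s^-1%g @: [set i : 'I_n | (N - r < i)%N].
  apply/setP=> i; rewrite -{2}[i](permK s) mem_imset ?inE //; exact: perm_inj.
rewrite card_imset; last exact: perm_inj.
by rewrite card_ord_ge subSS subKn.
Qed.

Lemma bars_ord0 s r : s ord0 = ord0 -> ord0 \notin bars s r.
Proof. by move=> s0; rewrite inE s0. Qed.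

Lemma path_chain_subproof s : s ord0 = ord0 ->
  is_maxchain [ffun r : 'I_n => path_part (bars s r)].
Proof.
move=> s0; apply/andP; split; apply/forallP=> r.
  by rewrite ffunE path_part_setpart rank_path_part ?bars_ord0 // card_bars ?leq_ord /=.
apply/forallP=> k; apply/implyP=> rk; rewrite !ffunE.
by apply/path_part_refines/bars_sub.
Qed.

Fact path_chain_spec s : {m : maxchain N |
  s ord0 = ord0 -> forall r, lev m r = path_part (bars s r)}.
Proof.
have [s0|s0] := eqVneq (s ord0) ord0.
  by exists (Sub _ (path_chain_subproof s0)) => _ r; rewrite /lev SubK ffunE.
by exists (Sub _ (path_chain_subproof (perm1 ord0))) => E; rewrite E eqxx in s0.
Qed.

(* Meaningful only for [s] fixing [0], which is not a bar. *)
Definition path_chain s : maxchain N := sval (path_chain_spec s).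

Lemma lev_path_chain s r : s ord0 = ord0 -> lev (path_chain s) r = path_part (bars s r).
Proof. by move=> s0; rewrite (svalP (path_chain_spec s)). Qed.

Variable S : {set 'I_n}.
Hypothesis rankS : forall r, r \in S -> (0 < r < N)%N.

Notation G := (young n).
Notation to := (max_action N).
Notation chainfun := (chainfun (maxchain N)).
Notation invfun := (invfun (@lev N) G to).
Notation lower := (lower (@lev N) G to).

Definition same_bars w s := [forall r : 'I_n, (r \notin S) ==> (bars s r == bars w r)].

Lemma same_bars_ord0 w s : w ord0 = ord0 -> same_bars w s -> s ord0 = ord0.
Proof.
move=> w0 /forall_inP/(_ ord_max) Es.
have /Es/eqP/setP/(_ ord0) : ord_max \notin S.
  by apply/negP=> /rankS; rewrite /= ltnn andbF.
by rewrite !inE subnn w0 ltnn lt0n => /negbFE/eqP s0; apply/val_inj.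
Qed.

Definition swap (r : nat) : 'S_n := tperm (inord (N - r)) (inord (N - r).+1).

Lemma swapE (r : nat) (i : 'I_n) : (0 < r <= N)%N ->
  swap r i = (if i == N - r :> nat then (N - r).+1
              else if i == (N - r).+1 :> nat then N - r else i)%N :> nat.
Proof.
move=> /andP[r0 rN]; have E1 : (inord (N - r) : 'I_n) = (N - r)%N :> nat.
  by rewrite inordK // ltnS leq_subr.
have E2 : (inord (N - r).+1 : 'I_n) = (N - r).+1 :> nat by rewrite inordK //; lia.
rewrite /swap; case: tpermP => [->|->|/eqP n1 /eqP n2].
- by rewrite E1 eqxx E2.
- by rewrite E2 eqxx E1 eqn_leq ltnn.
by rewrite -!val_eqE /= E1 E2 in n1 n2; rewrite (negPf n1) (negPf n2).
Qed.

Lemma bars_swap s (r k : nat) : (0 < r <= N)%N -> (k <= N)%N -> k != r ->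
  bars (s * swap r)%g k = bars s k.
Proof.
move=> rN kN kr; apply/setP=> i; rewrite !inE permM swapE //.
by case: eqP => [->|_]; [|case: eqP => [->|_]]; lia.
Qed.

Definition bars_sum w (f : chainfun) : rat :=
  \sum_(s | same_bars w s) (-1) ^+ s * (f (path_chain s) : rat).

Lemma bars_sumD w f1 f2 : bars_sum w (f1 + f2) = bars_sum w f1 + bars_sum w f2.
Proof. by rewrite -big_split; apply: eq_bigr => s _; rewrite ffunE mulrDr. Qed.

Lemma bars_sumZ w (a : rat) f : bars_sum w (a *: f) = a * bars_sum w f.
Proof. by rewrite mulr_sumr; apply: eq_bigr => s _; rewrite ffunE mulrCA. Qed.

Lemma bars_sum_lower w f : w ord0 = ord0 -> f \in lower S S -> bars_sum w f = 0.
Proof.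
move=> w0 /memv_sumP[fs fsS ->].
have -> : bars_sum w (\sum_(r in S) fs r) = \sum_(r in S) bars_sum w (fs r).
  elim/big_rec2: _ => [|r x f' _ <-]; last exact: bars_sumD.
  by apply: big1 => s _; rewrite ffunE mulr0.
apply: big1 => r rS; have /andP[r0 rN] := rankS rS.
have rN' : (0 < r <= N)%N by rewrite r0 ltnW.
suff : bars_sum w (fs r) = - bars_sum w (fs r) by move/eqP; rewrite -addr_eq0; lra.
rewrite {1}/bars_sum (reindex_inj (mulIg (swap r))) /= /bars_sum -sumrN.
have Ebars s : same_bars w (s * swap r)%g = same_bars w s.
  apply: eq_forallb => k; case kS: (k \in S) => //=; rewrite (bars_swap _ rN' (leq_ord k)) //.
  by apply: contraFN kS => /eqP/val_inj->.
rewrite (eq_bigl _ _ Ebars); apply: eq_bigr => s sw.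
have s0 : s ord0 = ord0 by apply: same_bars_ord0 sw.
rewrite odd_permM odd_tperm signr_addb -mulNr.
have -> : inord (N - r) != inord (N - r).+1 :> 'I_n.
  by rewrite -val_eqE /= !inordK ?ltnS ?leq_subr //; lia.
rewrite expr1 mulrN1; congr (_ * _).
apply: (invfun_finv (lev_act (N:=N)) (fsS r rS)); apply/agreeP=> k; rewrite in_setD1 => /andP[kr _].
rewrite !lev_path_chain //; first by rewrite (bars_swap _ rN' (leq_ord k)).
by apply: same_bars_ord0 w0 _; rewrite Ebars.
Qed.

Definition invtest (P : 'I_n -> {set {set 'I_n}} -> bool) : chainfun :=
  [ffun m => [forall r in S, P r (lev m r)]%:R].

Lemma invtest_inv (P : 'I_n -> nat -> bool) :
  invtest (fun r x => P r (marksize x)) \in invfun S.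
Proof.
apply/invfunP; first exact: lev_act.
move=> m m' /exists_inP[g gG /agreeP agr]; rewrite !ffunE; congr (nat_of_bool _)%:R.
apply: eq_forallb => r; case rS: (r \in S) => //=.
by rewrite -(agr r rS) lev_maxact marksize_act ?lev_setpart.
Qed.

Definition hooktest := invtest (fun r x => (r < marksize x)%N).

Lemma bars1 (r : nat) : bars 1 r = [set i : 'I_n | (N - r < i)%N].
Proof. by apply/setP=> i; rewrite !inE perm1. Qed.

Lemma hook_bars s (r : nat) : (r <= N)%N ->
  ([set i : 'I_n | (N - r < i)%N] \subset bars s r) = (bars s r == bars 1 r).
Proof.
by move=> rN; rewrite -bars1 [RHS]eq_sym eqEcard !card_bars // leqnn andbT.
Qed.

Lemma bars_sum_hooktest : bars_sum 1 hooktest = 1.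
Proof.
have s1 : same_bars 1 1 by apply/forall_inP.
rewrite /bars_sum (bigD1 1%g) //= odd_perm1 mul1r ffunE.
have -> : [forall r in S, (r < marksize (lev (path_chain 1) r))%N].
  apply/forall_inP=> r _; rewrite lev_path_chain ?perm1 // marksize_path_part ?leq_ord //.
  by rewrite hook_bars ?leq_ord.
rewrite big1 ?addr0 // => s /andP[sw s1']; rewrite ffunE.
have s0 : s ord0 = ord0 by apply: same_bars_ord0 sw; rewrite perm1.
case: forall_inP => [hookS|_]; last by rewrite mulr0.
case/eqP: s1'; apply: bars_inj => r.
have [rS|/(forall_inP sw)/eqP//] := boolP (r \in S).
have := hookS r rS; rewrite lev_path_chain // marksize_path_part ?leq_ord //.
by rewrite hook_bars ?leq_ord // => /eqP.
Qed.

Lemma hooktest_notin : hooktest \notin lower S S.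
Proof.
apply/negP=> /(bars_sum_lower (perm1 ord0)); rewrite bars_sum_hooktest.
by move/eqP; rewrite oner_eq0.
Qed.

Lemma dim_cons_line (U : {vspace chainfun}) f : f \notin U -> (\dim U < \dim (U + <[f]>)%VS)%N.
Proof.
move=> fU; rewrite ltnNge; apply: contra fU => le_dim.
have /eqP-> : (U == U + <[f]>)%VS by rewrite eqEdim addvSl.
by apply: subvP (addvSr _ _) _ (memv_line f).
Qed.

Lemma dim_lower_lt : (\dim (lower S S) < \dim (invfun S))%N.
Proof.
apply: leq_trans (dim_cons_line hooktest_notin) _; apply: dimvS.
rewrite subv_add -memvE; apply/andP; split; last exact: (invtest_inv (fun r k => r < k)%N).
exact: (lower_sub _ (@lev_act N)).
Qed.

Section Gap.

Variable h : nat.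
Hypotheses (h0 : (0 < h)%N) (h1N : (h.+1 < N)%N).
Hypotheses (hS : inord h \notin S) (h1S : inord h.+1 \in S).

Let hN : (0 < h <= N)%N. Proof. by rewrite h0 /= ltnW // ltnW. Qed.
Let h1N' : (0 < h.+1 <= N)%N. Proof. exact: ltnW. Qed.

Definition gaptest := invtest (fun r x =>
  if r == h.+1 :> nat then (marksize x <= h)%N else (r < marksize x)%N).

Lemma gaptestP w s : w ord0 = ord0 -> same_bars w s -> gaptest (path_chain s) != 0 ->
  (forall r : 'I_n, r \in S -> r != h.+1 :> nat -> bars s r = bars 1 r)
  /\ ~~ ([set i : 'I_n | (N - h < i)%N] \subset bars s h.+1).
Proof.
move=> w0 sw; have s0 := same_bars_ord0 w0 sw.
rewrite ffunE; case: forall_inP => [testS _|_]; last by rewrite eqxx.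
split=> [r rS rh|].
  have := testS r rS; rewrite (negPf rh) lev_path_chain // marksize_path_part ?leq_ord //.
  by rewrite hook_bars ?leq_ord // => /eqP.
have := testS _ h1S; rewrite inordK; last exact: ltnW.
rewrite eqxx lev_path_chain // inordK; last exact: ltnW.
by rewrite leqNgt marksize_path_part //; case/andP: hN.
Qed.

Lemma bars_sum1_gaptest : bars_sum 1 gaptest = 0.
Proof.
apply: big1 => s s1.
have [-> | /(gaptestP (perm1 ord0) s1)[_ /negP[]]] := eqVneq (gaptest (path_chain s)) 0.
  exact: mulr0.
have /eqP Eh : bars s (inord h : 'I_n) == bars 1 (inord h : 'I_n) by apply: (forall_inP s1).
rewrite inordK in Eh; last by apply: ltnW; apply: ltnW.
by rewrite -bars1 -Eh; apply: bars_sub.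
Qed.

Definition gapperm := (swap h * swap h.+1)%g.

Lemma swap_ord0 (r : nat) : (0 < r < N)%N -> swap r ord0 = ord0.
Proof.
move=> rN; apply/val_inj; rewrite /= swapE /=; last by lia.
by case: eqP => ?; lia.
Qed.

Lemma gapperm_ord0 : gapperm ord0 = ord0.
Proof. by rewrite permM !swap_ord0 ?h0 //= ltnW. Qed.

Lemma bars_swap_neq (r : nat) : (r <= N)%N -> r != h -> bars (swap h) r = bars 1 r.
Proof. by move=> rN rh; rewrite -[swap h]mul1g bars_swap. Qed.

Lemma bars_gapperm_neq (r : nat) : (r <= N)%N -> r != h.+1 -> bars gapperm r = bars (swap h) r.
Proof. by move=> rN rh; rewrite bars_swap. Qed.

Lemma gapperm_gt (i : 'I_n) : (N - h.+1 <= i)%N -> i != (N - h).+1 :> nat ->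
  (N - h.+1 < gapperm i)%N.
Proof.
move=> hi /eqP ih; rewrite permM swapE //; have := swapE i hN.
by case: eqP => [?|?]; [|case: eqP => [//|_]] => ->; do 2?case: eqP => ?; lia.
Qed.

Lemma same_bars_gapperm : same_bars (swap h) gapperm.
Proof.
apply/forall_inP=> r rS; rewrite bars_gapperm_neq ?leq_ord //.
apply: contraNneq rS => rh; rewrite (_ : r = inord h.+1) //.
by apply/val_inj; rewrite /= inordK // ltnW.
Qed.

Lemma gaptest_gapperm : gaptest (path_chain gapperm) = 1.
Proof.
rewrite ffunE (_ : [forall r in S, _] = true) //; apply/forall_inP=> r rS.
rewrite lev_path_chain ?gapperm_ord0 //; case: eqP => [->|/eqP rh].
  rewrite leqNgt marksize_path_part; last by case/andP: hN.
  apply/negP=> /subsetP/(_ (inord (N - h).+1)); rewrite !inE permM swapE //.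
  have := swapE (inord (N - h).+1) hN; rewrite inordK; last by lia.
  by rewrite eqxx ltnSn; case: eqP => [|_ ->]; do 2?case: eqP => ?; lia.
rewrite marksize_path_part ?leq_ord // hook_bars ?leq_ord //.
rewrite bars_gapperm_neq ?bars_swap_neq ?leq_ord //.
by apply: contraNneq hS => <-; rewrite inord_val.
Qed.

Lemma gaptest_unique s :
  same_bars (swap h) s -> gaptest (path_chain s) != 0 -> s = gapperm.
Proof.
move=> sw test; have w0 : swap h ord0 = ord0 by rewrite swap_ord0 // h0 ltnW.
have [hook gap] := gaptestP w0 sw test.
have off (r : 'I_n) : r != h.+1 :> nat -> bars s r = bars gapperm r.
  move=> rh; rewrite bars_gapperm_neq ?leq_ord //.
  have [rS|/(forall_inP sw)/eqP //] := boolP (r \in S).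
  rewrite hook // bars_swap_neq ?leq_ord //.
  by apply: contraNneq hS => <-; rewrite inord_val.
have off' (r : nat) : (r <= N)%N -> r != h.+1 -> bars s r = bars gapperm r.
  by move=> rN rh; have := off (inord r); rewrite inordK //; apply.
apply: bars_inj => r; have [rh|] := eqVneq (r : nat) h.+1; last exact: off.
rewrite rh; apply/eqP; rewrite eqEcard !card_bars // leqnn andbT.
have shE : bars s h = bars (swap h) h.
  by rewrite off' ?bars_gapperm_neq //; first [by rewrite ltn_eqF | by case/andP: hN].
have sh2E : bars s h.+2 = bars 1 h.+2.
  by rewrite off' ?bars_gapperm_neq ?bars_swap_neq ?gtn_eqF.
apply/subsetP=> i i1; rewrite inE; apply: gapperm_gt.
  have : i \in bars 1 h.+2 by rewrite -sh2E; apply: subsetP i1; apply: bars_sub.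
  by rewrite bars1 inE; lia.
apply: contra gap => /eqP ih; apply/subsetP=> j; rewrite inE => hj.
have [jh|jh] := eqVneq (j : nat) (N - h).+1.
  by rewrite (_ : j = i) //; apply/val_inj; rewrite /= ih.
apply: (subsetP (bars_sub s (leqnSn h))); rewrite shE inE swapE //.
by move/eqP: jh => jh; do 2?case: eqP => ?; lia.
Qed.

Lemma bars_sum_gaptest : bars_sum (swap h) gaptest != 0.
Proof.
rewrite /bars_sum (bigD1 gapperm same_bars_gapperm) /= gaptest_gapperm mulr1.
rewrite big1 ?addr0 ?signr_eq0 // => s /andP[sw ne].
have [->|/(gaptest_unique sw) Es] := eqVneq (gaptest (path_chain s)) 0; first exact: mulr0.
by rewrite Es eqxx in ne.
Qed.

Lemma dim_lower_gap : (\dim (lower S S) + 2 <= \dim (invfun S))%N.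
Proof.
pose U := (lower S S + <[hooktest]>)%VS.
have gapU : gaptest \notin U.
  apply/negP=> /memv_addP[f fL [_ /vlineP[a ->] E]].
  have w0 : swap h ord0 = ord0 by rewrite swap_ord0 // h0 ltnW.
  have := bars_sum1_gaptest; rewrite E bars_sumD bars_sumZ bars_sum_hooktest.
  rewrite (bars_sum_lower (perm1 ord0) fL) add0r mulr1 => a0.
  have := bars_sum_gaptest; rewrite E bars_sumD bars_sumZ (bars_sum_lower w0 fL).
  by rewrite a0 mul0r addr0 eqxx.
have := dim_cons_line hooktest_notin; have := dim_cons_line gapU; rewrite -/U => lt1 lt2.
have : (\dim (U + <[gaptest]>)%VS <= \dim (invfun S))%N.
  apply: dimvS; rewrite !subv_add -!memvE -andbA; apply/and3P; split.
  - exact: (lower_sub _ (@lev_act N)).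
  - exact: (invtest_inv (fun r k => r < k)%N).
  exact: (invtest_inv (fun r k => if r == h.+1 :> nat then k <= h else r < k)%N).
by move=> le; rewrite addn2; apply: leq_trans le; apply: leq_ltn_trans lt1.
Qed.

End Gap.

End LowerBound.

(** * Initial segments *)

Section Singles.

Variable N : nat.
Notation n := N.+1.
Implicit Types (x y : {set {set 'I_n}}) (a b c d : 'I_n).

Definition single x a := [forall b, same x a b ==> (b == a)].

Lemma singleP x a b : x \in setpart n -> single x a -> same x a b = (a == b).
Proof.
move=> xP /forall_inP xa; apply/idP/eqP=> [/xa/eqP->|<-] //; exact: same_refl.
Qed.

Lemma single_refines x y a : x \in setpart n -> y \in setpart n ->
  refines x y -> single y a -> single x a.
Proof.
move=> xP yP /refinesP-/(_ xP yP) xy /forall_inP ya.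
by apply/forall_inP=> b /xy/ya.
Qed.

Lemma single_glue x a b c : x \in setpart n ->
  single x c -> c != a -> c != b -> single (glue x a b) c.
Proof.
move=> xP xc ca cb; apply/forall_inP=> d.
by rewrite same_glue // !(singleP _ xP xc) (negPf ca) (negPf cb) !orbF eq_sym.
Qed.

Lemma glue_congr x a a' b : x \in setpart n -> same x a a' -> glue x a b = glue x a' b.
Proof.
move=> xP aa'; apply: same_inj; rewrite ?glue_setpart // => i j.
rewrite !same_glue // ![same x _ a]same_sym // ![same x _ a']same_sym //.
by rewrite !(same_congr _ xP aa').
Qed.

Lemma same_actV x g i j : x \in setpart n ->
  same (part_action n x g) i j = same x (g^-1%g i) (g^-1%g j).
Proof. by move=> xP; rewrite -[in RHS](same_act g) // !permKV. Qed.

Lemma single_tperm x a b : x \in setpart n -> single x a -> single x b ->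
  part_action n x (tperm a b) = x.
Proof.
move=> xP xa xb; apply: same_inj; rewrite ?setpart_act // => i j.
rewrite same_actV // tpermV; pose u := tperm a b.
have sE k l : single x k || single x l -> same x k l = (k == l).
  case/orP=> sk; first exact: singleP.
  by rewrite same_sym // (singleP _ xP sk) eq_sym.
have su k : single x k -> single x (u k) by rewrite /u; case: tpermP.
have fix_u k : ~~ single x k -> u k = k.
  by move=> sk; rewrite tpermD //; apply: contraNneq sk => <-.
have [sij|] := boolP (single x i || single x j); last first.
  by case/norP=> si sj; rewrite !fix_u.
rewrite !sE ?(inj_eq perm_inj) //.
by case/orP: sij => /su-> //; rewrite orbT.
Qed.

Lemma same_tperm x a b : x \in setpart n -> same x a b ->
  part_action n x (tperm a b) = x.
Proof.
move=> xP ab; apply: same_inj; rewrite ?setpart_act // => i j.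
rewrite same_actV // tpermV; have st k : same x (tperm a b k) k.
  by case: tpermP => [->|->|_ _]; rewrite ?same_refl // same_sym.
by rewrite (same_congr _ xP (st i)) same_sym // (same_congr _ xP (st j)) same_sym.
Qed.

Definition hook_step y x :=
  [exists a, [&& single y a, a != ord_max & x == glue y a ord_max]].

Definition pair_step y x :=
  [exists a, exists b, [&& a != b, single y a, single y b, a != ord_max, b != ord_max
                        & x == glue y a b]].

Lemma young_tperm a b : a != ord_max -> b != ord_max -> tperm a b \in young n.
Proof. by move=> am bm; rewrite young_fix tpermD // eq_sym. Qed.

End Singles.

Section InitialSegment.

Variables (N t : nat).
Notation n := N.+1.
Hypothesis tN : (t < N)%N.
Implicit Types (x y : {set {set 'I_n}}) (a b c d : 'I_n) (m : maxchain N).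

Notation G := (young n).
Notation to := (max_action N).
Notation chainfun := (chainfun (maxchain N)).
Notation invfun := (invfun (@lev N) G to).
Notation lower := (lower (@lev N) G to).
Notation oagree := (oagree (@lev N) G to).
Notation agree := (agree (@lev N)).
Notation orbit_ind := (orbit_ind (@lev N) G to).

Definition initseg : {set 'I_n} := [set r : 'I_n | (0 < r <= t)%N].
Notation S := initseg.

Lemma initsegP (k : nat) : (0 < k <= t)%N -> (inord k : 'I_n) \in S.
Proof. by move=> /andP[k0 kt]; rewrite inE inordK ?k0 // ltnS; lia. Qed.

Lemma agree_off (s k : nat) m m' :
    agree (S :\ inord s) m' m -> (k <= t)%N -> k != s -> (s <= t)%N -> lvl m' k = lvl m k.
Proof.
move=> /agreeP agr; case: k => [|k] kt ks st; first by rewrite !lvl0.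
apply: agr; rewrite in_setD1 initsegP // andbT; apply: contraNneq ks.
by move/(congr1 val); rewrite /= !inordK //; [move=> -> | lia | lia].
Qed.

Lemma oagree_lvl m m' g : g \in G ->
    (forall k : nat, (k <= t)%N -> part_action n (lvl m k) g = lvl m' k) ->
  oagree S m m'.
Proof.
move=> gG mgE; apply: (oagree_act (g := g)) => //; apply/agreeP=> r.
by rewrite inE => /andP[_ rt]; rewrite !lev_lvl lvl_act mgE.
Qed.

Lemma pair_orbit (s : nat) m m' a b d : (s < t)%N ->
    agree (S :\ inord s.+1) m' m ->
    single (lvl m s) b -> single (lvl m s) d ->
    b != ord_max -> d != ord_max -> a != b -> a != d ->
    lvl m s.+1 = glue (lvl m s) a b -> lvl m' s.+1 = glue (lvl m s) a d ->
  oagree S m m'.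
Proof.
move=> st agr sb sd bm dm ab ad Eb Ed.
apply: oagree_lvl (young_tperm bm dm) _ => k kt; have mP := lvl_setpart m.
have kN : (k <= N)%N by lia.
have [->|ks] := eqVneq k s.+1.
  rewrite Eb Ed glue_act // single_tperm //.
  by rewrite tpermL tpermD // eq_sym.
rewrite (agree_off agr) //; have [ks'|sk] := leqP k s.
  have le_ks : (k <= s <= N)%N by rewrite ks' ltnW // (ltn_trans st).
  by apply: single_tperm; rewrite ?(single_refines _ _ (lvl_refines m le_ks)).
apply: same_tperm => //; have sk1 : (s.+1 <= k <= N)%N by rewrite sk.
have gP m1 e : lvl m1 s.+1 = glue (lvl m s) a e -> same (lvl m1 k) a e.
  move=> E; apply: (refinesP _ _ (lvl_refines m1 sk1)); rewrite ?lvl_setpart //.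
  by rewrite E same_glue // !same_refl // orbT.
have := gP m' d Ed; rewrite (agree_off agr) // => akd.
by apply: same_trans akd => //; rewrite same_sym // gP.
Qed.

Lemma pair_orbit_share (s : nat) m m' a b c d : (s < t)%N ->
    agree (S :\ inord s.+1) m' m ->
    a != b -> c != d ->
    (forall e, e \in [:: a; b; c; d] -> single (lvl m s) e && (e != ord_max)) ->
    lvl m s.+1 = glue (lvl m s) a b -> lvl m' s.+1 = glue (lvl m s) c d ->
    [|| c == a, c == b, d == a | d == b] ->
  oagree S m m'.
Proof.
move=> st agr; have mP := lvl_setpart m s.
move=> ab cd eP Eb Ed.
have [[sa am] [sb bm] [sc cm] [sd dm]] : [/\ single (lvl m s) a /\ a != ord_max,
    single (lvl m s) b /\ b != ord_max, single (lvl m s) c /\ c != ord_max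
    & single (lvl m s) d /\ d != ord_max].
  by split; apply/andP/eP; rewrite !inE eqxx ?orbT.
case/or4P=> /eqP E.
- by apply: (pair_orbit st agr sb sd bm dm ab _ Eb); rewrite -E.
- rewrite glueC // in Eb; apply: (pair_orbit st agr sa sd am dm _ _ Eb); rewrite -?E //.
  by rewrite E eq_sym.
- rewrite glueC // E in Ed; rewrite E eq_sym in cd.
  exact: (pair_orbit st agr sb sc bm cm ab cd Eb Ed).
rewrite glueC // in Eb; rewrite glueC // E in Ed; rewrite E eq_sym in cd.
by rewrite eq_sym in ab; apply: (pair_orbit st agr sa sc am cm ab cd Eb Ed).
Qed.

Lemma pair_orbit_disjoint (s : nat) m m' a b c d : s.+1 = t ->
    agree (S :\ inord s.+1) m' m ->
    (forall e, e \in [:: a; b; c; d] -> single (lvl m s) e && (e != ord_max)) ->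
    lvl m s.+1 = glue (lvl m s) a b -> lvl m' s.+1 = glue (lvl m s) c d ->
    uniq [:: a; b; c; d] ->
  oagree S m m'.
Proof.
move=> st agr eP Eb Ed; have mP := lvl_setpart m.
have [[sa am] [sb bm] [sc cm] [sd dm]] : [/\ single (lvl m s) a /\ a != ord_max,
    single (lvl m s) b /\ b != ord_max, single (lvl m s) c /\ c != ord_max
    & single (lvl m s) d /\ d != ord_max].
  by split; apply/andP/eP; rewrite !inE eqxx ?orbT.
rewrite /= !inE !negb_or andbT => /and3P[/and3P[ab ac ad] /andP[bc bd] cd].
have gG : (tperm a c * tperm b d)%g \in G by rewrite groupM ?young_tperm.
apply: oagree_lvl gG _ => k kt; rewrite actM.
have [ks|sk] := leqP k s.
  have le_ks : (k <= s <= N)%N by rewrite ks /=; apply: ltnW; rewrite st ltnW.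
  have sk e : single (lvl m s) e -> single (lvl m k) e.
    by apply: single_refines => //; apply: lvl_refines.
  by rewrite !single_tperm ?sk // (agree_off agr) ?st // neq_ltn -st ltnS ks.
have -> : k = s.+1 by apply/eqP; rewrite eqn_leq sk st kt.
rewrite Eb Ed !glue_act ?setpart_act // !single_tperm // !tpermL.
by rewrite [tperm a c b]tpermD ?tpermL ?tpermD // eq_sym.
Qed.

Definition hooks (r : nat) m :=
  forall k : nat, (k < r)%N -> hook_step (lvl m k) (lvl m k.+1).
Definition pairs (r j : nat) m :=
  forall k : nat, (r <= k < r + j)%N -> pair_step (lvl m k) (lvl m k.+1).

Lemma hooks_single r m a : (r <= N)%N -> hooks r m ->
  single (lvl m r) a || same (lvl m r) a ord_max.
Proof.
elim: r a => [|r IHr] a rN hk.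
  by apply/orP; left; apply/forall_inP=> b; rewrite lvl0 same_part0 eq_sym.
have yP := lvl_setpart m r.
have /existsP[b /and3P[sb bm /eqP->]] := hk r (ltnSn r).
rewrite same_glue //; have [->|ab] := eqVneq a b; first by rewrite !same_refl // !orbT.
have /orP[sa|->] := IHr a (ltnW rN) (fun k kr => hk k (ltnW kr)); last by rewrite orbT.
have [->|am] := eqVneq a ord_max; first by rewrite same_refl // orbT.
by rewrite single_glue.
Qed.

Lemma hooks_next r m : (r < N)%N -> hooks r m ->
  ~~ pair_step (lvl m r) (lvl m r.+1) -> hook_step (lvl m r) (lvl m r.+1).
Proof.
move=> rN hk npair; have yP := lvl_setpart m r.
have [a [b [ab E]]] := lvl_cover m rN.
have hkE c : ~~ same (lvl m r) c ord_max -> lvl m r.+1 = glue (lvl m r) c ord_max ->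
    hook_step (lvl m r) (lvl m r.+1).
  move=> cm Ec; apply/existsP; exists c; rewrite Ec eqxx andbT.
  have := hooks_single c (ltnW rN) hk; rewrite (negPf cm) orbF => -> /=.
  by apply: contraNneq cm => ->; apply: same_refl.
have [bm|bm] := boolP (same (lvl m r) b ord_max).
  apply: (hkE a); first by apply: contra ab => am; apply: same_trans am _; rewrite // same_sym.
  by rewrite E glueC // (glue_congr _ yP bm) glueC.
have [am|am] := boolP (same (lvl m r) a ord_max).
  apply: (hkE b) => //.
  by rewrite E (glue_congr _ yP am) glueC.
case/negP: npair; apply/existsP; exists a; apply/existsP; exists b.
have := hooks_single a (ltnW rN) hk; have := hooks_single b (ltnW rN) hk.
rewrite (negPf am) (negPf bm) !orbF E eqxx andbT => -> -> /=.
apply/and3P; split.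
- by apply: contraNneq ab => ->; apply: same_refl.
- by apply: contraNneq am => ->; apply: same_refl.
by apply: contraNneq bm => ->; apply: same_refl.
Qed.

Section Spanning.

Variable U : {vspace chainfun}.
Hypothesis lowerU : (lower S S <= U)%VS.
Hypothesis hooksU : forall m, hooks t m -> orbit_ind S m \in U.

Lemma hooks_agree (r s : nat) m m' : agree (S :\ inord s) m' m -> (r < s <= t)%N ->
  hooks r m -> hooks r m'.
Proof.
move=> agr /andP[rs st] hk k kr.
by rewrite !(agree_off agr) ?hk // ?neq_ltn; lia.
Qed.

Lemma pairs_agree (r j s : nat) m m' : agree (S :\ inord s) m' m -> (r + j < s <= t)%N ->
  pairs r j m -> pairs r j m'.
Proof.
move=> agr /andP[rs st] pm k kr.
by rewrite !(agree_off agr) ?pm // ?neq_ltn; lia.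
Qed.

Lemma pair_step_inv y x : pair_step y x ->
  exists a b, [/\ a != b, x = glue y a b &
    forall e, e \in [:: a; b] -> single y e && (e != ord_max)].
Proof.
case/existsP=> a /existsP[b /and5P[ab sa sb am /andP[bm /eqP E]]].
exists a, b; split=> // e; rewrite !inE => /orP[]/eqP->; first by rewrite sa.
by rewrite sb.
Qed.

Lemma pair_steps_cases (s : nat) m m' : (s < t)%N -> agree (S :\ inord s.+1) m' m ->
    pair_step (lvl m s) (lvl m s.+1) -> pair_step (lvl m s) (lvl m' s.+1) ->
  oagree S m m' \/ exists a b c d, [/\ uniq [:: a; b; c; d],
    forall e, e \in [:: a; b; c; d] -> single (lvl m s) e && (e != ord_max),
    lvl m s.+1 = glue (lvl m s) a b & lvl m' s.+1 = glue (lvl m s) c d].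
Proof.
move=> st agr /pair_step_inv[a [b [ab Eb abP]]] /pair_step_inv[c [d [cd Ed cdP]]].
have eP e : e \in [:: a; b; c; d] -> single (lvl m s) e && (e != ord_max).
  rewrite (mem_cat e [:: a; b] [:: c; d]) => /orP[]; [exact: abP | exact: cdP].
have [share|] := boolP [|| c == a, c == b, d == a | d == b].
  by left; apply: pair_orbit_share st agr ab cd eP Eb Ed share.
rewrite !negb_or => /and4P[ca cb da db]; right; exists a, b, c, d; split=> //.
by rewrite /= !inE !negb_or ab cd ![_ == c]eq_sym ca cb ![_ == d]eq_sym da db.
Qed.

(* The step after the pairs is moved down past the last pair; the only other
   elements of the length-two interval in question are conjugate to the given one. *)
Lemma pairs_then_other (r : nat) :
    (forall m, hooks r.+1 m -> orbit_ind S m \in U) ->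
  forall j m, hooks r m -> pairs r j m -> (r + j < t)%N ->
    ~~ pair_step (lvl m (r + j)) (lvl m (r + j).+1) -> orbit_ind S m \in U.
Proof.
move=> IHr; elim=> [|j IHj] m hk pm rjt nps.
  apply: IHr => k; rewrite ltnS leq_eqVlt => /predU1P[->|]; last exact: hk.
  rewrite addn0 in rjt nps; apply: hooks_next => //; exact: ltn_trans tN.
have rjt' : ((r + j).+1 < t)%N by rewrite -addnS.
rewrite addnS in nps; have sS : (0 < (r + j).+1 <= t)%N by apply: ltnW.
refine (orbit_ind_step (@lev_act N) (initsegP sS) lowerU _) => m' agr.
have Ey : lvl m' (r + j) = lvl m (r + j).
  by apply: agree_off agr _ _ _; rewrite ?neq_ltn ?ltnSn //; do 2?apply: ltnW.
have ps : pair_step (lvl m (r + j)) (lvl m (r + j).+1).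
  by apply: pm; rewrite leq_addr addnS ltnSn.
have [ps'|nps'] := boolP (pair_step (lvl m' (r + j)) (lvl m' (r + j).+1)); last first.
  left; apply: IHj nps'; [apply: hooks_agree agr _ hk|apply: pairs_agree agr _ _|].
  - by rewrite ltnS leq_addr; apply: ltnW.
  - by rewrite ltnSn; apply: ltnW.
  - by move=> k /andP[rk kr]; apply: pm; rewrite rk addnS ltnS ltnW.
  exact: ltnW.
rewrite Ey in ps'.
have [|[a [b [c [d [abcd eP Eb Ed]]]]]] := pair_steps_cases (ltnW rjt') agr ps ps'; first by right.
have [mP m'P] := (lvl_setpart m, lvl_setpart m').
have rjN : ((r + j).+1 < N)%N by apply: ltn_trans tN.
case/negP: nps; move: abcd; rewrite /= !inE !negb_or andbT.
case/and3P=> /and3P[ab ac ad] /andP[bc bd] cd.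
have [[sc cm] [sd dm]] : (single (lvl m (r + j)) c /\ c != ord_max)
    /\ (single (lvl m (r + j)) d /\ d != ord_max).
  by split; apply/andP/eP; rewrite !inE eqxx ?orbT.
have sg e : single (lvl m (r + j)) e -> e != a -> e != b -> single (lvl m (r + j).+1) e.
  by move=> se ea eb; rewrite Eb single_glue.
have sc1 : single (lvl m (r + j).+1) c by rewrite sg // eq_sym.
have sd1 : single (lvl m (r + j).+1) d by rewrite sg // eq_sym.
apply/existsP; exists c; apply/existsP; exists d; rewrite cd sc1 sd1 cm dm /=.
apply/eqP/esym/refines_eq => //; first exact: glue_setpart.
  apply: glue_refines => //; first by apply: lvl_refines; rewrite leqnSn.
  have -> : lvl m (r + j).+2 = lvl m' (r + j).+2.
    by apply/esym/(agree_off agr) => //; rewrite ?neq_ltn ?ltnSn ?orbT // ltnW.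
  apply: (refinesP (m'P (r + j).+1) (m'P _) _); first by apply: lvl_refines; rewrite leqnSn.
  by rewrite Ed same_glue // !same_refl // orbT.
by rewrite rank_glue ?(singleP _ _ sc1) // !rank_lvl // ltnW.
Qed.

Lemma hooks_pairs_good (r : nat) :
    (forall m, hooks r.+1 m -> orbit_ind S m \in U) ->
  forall q j m, (r + j + q = t)%N -> hooks r m -> pairs r j m -> orbit_ind S m \in U.
Proof.
move=> IHr; elim=> [|q IHq] j m rjq hk pm; last first.
  have [ps|nps] := boolP (pair_step (lvl m (r + j)) (lvl m (r + j).+1)).
    apply: (IHq j.+1) hk _; first by rewrite addnS addSn -addnS.
    move=> k /andP[rk]; rewrite addnS ltnS leq_eqVlt => /predU1P[->//|kj].
    by apply: pm; rewrite rk.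
  by apply: pairs_then_other nps => //; rewrite -rjq -addSnnS leq_addr.
rewrite addn0 in rjq; case: j => [|j] in rjq pm.
  by apply: hooksU; rewrite -rjq addn0.
rewrite addnS in rjq; have sS : (0 < (r + j).+1 <= t)%N by rewrite ltn0Sn rjq leqnn.
have rjt : (r + j < t)%N by rewrite -rjq.
refine (orbit_ind_step (@lev_act N) (initsegP sS) lowerU _) => m' agr.
have Ey : lvl m' (r + j) = lvl m (r + j).
  by apply: agree_off agr _ _ _; rewrite ?neq_ltn ?ltnSn //; apply: ltnW.
have ps : pair_step (lvl m (r + j)) (lvl m (r + j).+1).
  by apply: pm; rewrite leq_addr addnS ltnSn.
have [ps'|nps'] := boolP (pair_step (lvl m' (r + j)) (lvl m' (r + j).+1)); last first.
  left; apply: (pairs_then_other IHr _ _ rjt nps').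
    by apply: hooks_agree agr _ hk; rewrite ltnS leq_addr.
  apply: pairs_agree agr _ _; first by rewrite ltnSn.
  by move=> k /andP[rk kr]; apply: pm; rewrite rk addnS ltnS ltnW.
rewrite Ey in ps'; right.
have [//|[a [b [c [d [abcd eP Eb Ed]]]]]] := pair_steps_cases rjt agr ps ps'.
exact: pair_orbit_disjoint rjq agr eP Eb Ed abcd.
Qed.

Lemma invfun_initseg : (invfun S <= U)%VS.
Proof.
have good r : (r <= t)%N -> forall m, hooks r m -> orbit_ind S m \in U.
  move=> rt; rewrite -(subKn rt); move: (t - r)%N (leq_subr r t).
  elim=> [|q IHq] qt m; first by rewrite subn0; apply: hooksU.
  move=> hk; apply: (@hooks_pairs_good (t - q.+1)%N _ q.+1 0%N m _ hk).
  - by rewrite subnSK //; apply: IHq; apply: ltnW.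
  - by rewrite addn0 subnK.
  by move=> k; rewrite addn0; case/andP=> le1 /(leq_ltn_trans le1); rewrite ltnn.
by apply/span_subvP=> _ /mapP[m _ ->]; apply: (good 0%N).
Qed.

End Spanning.

Lemma single_act x g a : x \in setpart n -> single x a -> single (part_action n x g) (g a).
Proof.
move=> xP /forall_inP xa; apply/forall_inP=> b; rewrite -[b](permKV g) same_act //.
by move/xa/eqP->.
Qed.

Lemma hooks_oagree m m' : hooks t m -> hooks t m' -> oagree S m m'.
Proof.
move=> hk hk'; suff [g gG gE] : exists2 g, g \in G &
    forall k : nat, (k <= t)%N -> part_action n (lvl m k) g = lvl m' k.
  exact: oagree_lvl gG gE.
elim: {-2}t (leqnn t) => [|r IHr] rt.
  exists 1%g => [|k]; first exact: group1.
  by rewrite leqn0 => /eqP->; rewrite act1 !lvl0.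
have [g gG gE] := IHr (ltnW rt).
have /existsP[a /and3P[sa am /eqP Ea]] := hk r rt.
have /existsP[b /and3P[sb bm /eqP Eb]] := hk' r rt.
have gm : g ord_max = ord_max by apply/eqP; rewrite -young_fix.
have sga : single (lvl m' r) (g a) by rewrite -gE // single_act ?lvl_setpart.
have gam : g a != ord_max by rewrite -gm (inj_eq perm_inj).
exists (g * tperm (g a) b)%g => [|k]; first by rewrite groupM // young_tperm.
rewrite leq_eqVlt => /predU1P[->|kr].
  rewrite Ea actM glue_act ?lvl_setpart // (gE r (leqnn r)) glue_act ?lvl_setpart //.
  by rewrite single_tperm ?lvl_setpart // gm tpermL tpermD.
have krN : (k <= r <= N)%N by rewrite -ltnS kr; lia.
rewrite actM gE //; apply: single_tperm; first exact: lvl_setpart.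
  by apply: (single_refines _ _ (lvl_refines m' krN) sga); apply: lvl_setpart.
by apply: (single_refines _ _ (lvl_refines m' krN) sb); apply: lvl_setpart.
Qed.

Lemma dim_lower_initseg : (\dim (invfun S) <= (\dim (lower S S)).+1)%N.
Proof.
have lowS := lower_sub (young n) (@lev_act N) S S.
case: (pickP (fun m => [forall k : 'I_t, hook_step (lvl m k) (lvl m k.+1)])) => [m0 hk0|nohk].
  have h0 : hooks t m0 by move=> k kt; have /forallP/(_ (Ordinal kt)) := hk0.
  have subU : (invfun S <= lower S S + <[orbit_ind S m0]>)%VS.
    apply: invfun_initseg => [|m hk]; first exact: addvSl.
    rewrite (orbit_ind_oagree (@lev_act N) (hooks_oagree hk h0)).
    exact: subvP (addvSr _ _) _ (memv_line _).
  apply: leq_trans (dimvS subU) _; apply: leq_trans (leq_of_leqif (dimv_add_leqif _ _)) _.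
  by rewrite -[(\dim _).+1]addn1 leq_add2l dim_vline; case: eqP.
apply/leqW/dimvS/invfun_initseg => // m hk.
by have /forallP[] := nohk m; move=> k; apply: hk.
Qed.

End InitialSegment.

Lemma gap_or_initseg N (S : {set 'I_N.+1}) : (0 < N)%N ->
    (forall r, r \in S -> (0 < r < N)%N) ->
  (exists2 t : nat, (t < N)%N & S = initseg N t)
  \/ exists h : nat, [/\ (0 < h)%N, (h.+1 < N)%N, inord h \notin S & inord h.+1 \in S].
Proof.
move=> N0 SP; pose gap (h : 'I_N.+1) := [&& (0 < h)%N, h \notin S & inord h.+1 \in S].
have [h /and3P[h0 hS h1S]|nogap] := pickP gap.
  right; exists h; rewrite inord_val h0 hS h1S; split=> //.
  have [hN|Nh] := ltnP h N; first by have := SP _ h1S; rewrite inordK // ltnS.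
  have E : h = N :> nat by apply/eqP; rewrite eqn_leq -ltnS ltn_ord.
  move: h1S; rewrite /inord /insubd insubF; last by rewrite E ltnn.
  by move/SP.
left; have [-> | [r0 r0S]] := set_0Vmem S.
  by exists 0%N => //; apply/setP=> r; rewrite !inE; case: (r : nat).
case: (@arg_maxnP _ r0 (mem S) (@nat_of_ord _) r0S) => t tS maxt.
have /andP[t0 tN] := SP t tS; exists t => //; apply/setP=> r; rewrite inE.
apply/idP/andP=> [rS|[r0' rt]]; first by have /andP[-> _] := SP r rS; split=> //; apply: maxt.
have down (d : nat) : (d < t)%N -> inord (t - d) \in S.
  elim: d => [|d IHd] dt; first by rewrite subn0 inord_val.
  have dN : (t - d.+1 < N.+1)%N by lia.
  have := nogap (inord (t - d.+1)); rewrite /gap inordK // subn_gt0 dt subnSK // ?(ltnW dt) //.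
  by rewrite IHd ?(ltnW dt) // andbT => /negbFE.
by have := down (t - r)%N; rewrite subKn // inord_val; apply; lia.
Qed.

Theorem theorem4p5 (n : nat) (S : {set 'I_n})
    (hn : (3 <= n)%N)
    (hS : forall r : 'I_n, r \in S -> (1 <= r <= n - 2)%N) :
  ((exists2 i : nat, (i <= n - 2)%N & S = [set r : 'I_n | (1 <= r <= i)%N]) ->
     bprime S = 1%R)
  /\
  (~ (exists2 i : nat, (i <= n - 2)%N & S = [set r : 'I_n | (1 <= r <= i)%N]) ->
     (1 < bprime S)%R).
Proof.
case: n => [//|N] in S hn hS *; have N0 : (0 < N)%N by apply: ltnW.
have SP r : r \in S -> (0 < r < N)%N by move/hS=> /andP[-> rN] /=; lia.
rewrite bprime_dim //; split=> [[t tN ES]|noninit].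
  have tN' : (t < N)%N by lia.
  have {}ES : S = initseg N t := ES.
  have le_dim := dim_lower_initseg tN'; rewrite -ES in le_dim.
  have lt_dim := dim_lower_lt SP.
  have -> : \dim (invfun (@lev N) (young N.+1) (max_action N) S)
          = (\dim (lower (@lev N) (young N.+1) (max_action N) S S)).+1.
    by apply/eqP; rewrite eqn_leq le_dim lt_dim.
  by rewrite -addn1 natrD addrAC subrr add0r.
have [[t tN ES]|[h [h0 hN hS' h1S]]] := gap_or_initseg N0 SP.
  by case: noninit; exists t => //; lia.
have := dim_lower_gap SP h0 hN hS' h1S.
by rewrite -(ler_nat algC) natrD ltrBrDl => /(lt_le_trans _); apply; rewrite ltrD2l ltr1n.
Qed.
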